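(* For all $t\in[0,2\pi)$ one has, almost surely, $$\lambda^2d_\lambda(t,\cdot)\longrightarrow Z(t,\cdot)\quad\text{as }\lambda\to+\infty,$$ where $Z(t,\cdot)$ is the random variable $$Z(t,\omega)=-\frac{L(t,\omega)^2}{2}\,\frac{\cos\bigl(2(\Theta(t,\omega)-t)\bigr)}{R(t,\omega)\cos(\Theta(t,\omega)-t)},$$ and the joint law of $(L(t,\cdot),\Theta(t,\cdot),R(t,\cdot))$ (the angle $\Theta$ being taken modulo $2\pi$ in $(t-\pi,t+\pi]$) is $$e^{-2\ell}\cos(\alpha-t)\,\mathbf{1}_{\alpha\in(t-\pi/2,\,t+\pi/2)}\,\mathrm{d}\ell\,\mathrm{d}\alpha\,\mathrm{d}\mu(r),\qquad \ell>0.$$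
   Context: Let $\mu$ be a probability measure on $\mathbb{R}_+$ with $\int R\,\mathrm{d}\mu(R)=1$, $\int R^2\,\mathrm{d}\mu(R)<+\infty$ and $\mu((R_\star,+\infty))=1$ for some $R_\star>0$. Let $\mathbf{Z}$ be a Poisson point process on $\mathbb{R}_+\times[0,2\pi)\times\mathbb{R}_+$ with intensity measure $\mathrm{d}\rho\,\mathrm{d}\theta\,\mathrm{d}\mu(R)$; everything below is built from this single process, simultaneously for all $\lambda>0$. Line process and Crofton cell: to each $(\rho,\theta,R)\in\mathbf{Z}$ associate the line $D_{\rho,\theta}=\{x\in\mathbb{R}^2:\ x_1\cos\theta+x_2\sin\theta=\rho\}$. The Crofton cell $\mathcal{C}$ is the closed (almost surely bounded) convex polygon containing $0$ which is the closure of the connected component containing $0$ of the complement of the union of these lines. Coupled disc model: let $\psi_\lambda(\rho,R)=R\sqrt{1+2\rho/(\lambda^2R)}$. To each $(\rho,\theta,R)\in\mathbf{Z}$ associate the open disc of radius $R$ whose centre has polar coordinates $(\psi_\lambda(\rho,R),\theta)$, and let $\mathcal{O}_\lambda$ be the union of these discs (it does not contain $0$). Let $D_0^\lambda$ be the connected component of $\mathbb{R}^2\setminus\mathcal{O}_\lambda$ containing $0$, and let $D^\lambda=\lambda^2D_0^\lambda$ if this set is bounded, $D^\lambda=K_0$ (a given fixed compact set) otherwise. For $t\in[0,2\pi)$ let $\Delta_t$ be the open half-line from $0$ in direction $t$. Let $(\Upsilon(t),\Theta(t),R(t))\in\mathbf{Z}$ be the marked point whose line supports the edge of $\mathcal{C}$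 intersected by $\Delta_t$ ($\Upsilon(t)$ is the distance from $0$ to the line, $\Theta(t)$ its polar angle, $R(t)$ the associated radius), and let $L(t)=\Upsilon(t)/\cos(\Theta(t)-t)$ be the distance from $0$ to the intersection of $\Delta_t$ with this edge. The defect at angle $t$ is $$d_\lambda(t)=\operatorname{dist}(0,\Delta_t\cap\partial D^\lambda)-\operatorname{dist}(0,\Delta_t\cap\partial\mathcal{C}),$$ with $\operatorname{dist}$ the Euclidean distance. *)

(* Defs.v *)
From mathcomp Require Import all_boot all_order all_algebra.
From mathcomp Require Import all_classical all_reals all_analysis.
From mathcomp Require Import measurable_realfun.
Set Implicit Arguments.
Unset Strict Implicit.
Unset Printing Implicit Defensive.
Import Order.TTheory GRing.Theory Num.Theory.
Import numFieldNormedType.Exports.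
Local Open Scope classical_set_scope.
Local Open Scope ring_scope.

Section random.
Context (R : realType) (d : measure_display) (Omega : measurableType d)
  (P : probability Omega R).
Context (d' : measure_display) (T : measurableType d').

Definition npoints (Z : Omega -> set T) (A : set T) (w : Omega) : \bar R :=
  counting (Z w `&` A).

(* A Poisson point process on the state space E with intensity Lambda, as a
   random countable subset of E; this encoding requires Lambda to have no atoms.
   The law is spelled out because poisson_pmf 0 k is 1 for every k. *)
Record poisson_process (E : set T) (Lambda : set T -> \bar R)
    (Z : Omega -> set T) : Prop := PoissonProcess {
  pp_sub : forall w, Z w `<=` E ;
  pp_countable : forall w, countable (Z w) ;
  pp_measurable : forall A : set T, measurable A -> A `<=` E ->
    measurable_fun setT (npoints Z A) ;
  pp_law : forall A : set T, measurable A -> A `<=` E ->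
    (Lambda A < +oo)%E -> forall k : nat,
    P [set w | npoints Z A w = k%:R%:E] =
      (expR (- fine (Lambda A)) * fine (Lambda A) ^+ k / k`!%:R)%:E ;
  pp_law_infty : forall A : set T, measurable A -> A `<=` E ->
    Lambda A = +oo%E -> P [set w | npoints Z A w = +oo%E] = 1%E ;
  pp_indep : forall (n : nat) (A : 'I_n -> set T) (B : 'I_n -> set (\bar R)),
    (forall i, measurable (A i)) -> (forall i, A i `<=` E) ->
    (forall i j, i != j -> A i `&` A j = set0) ->
    (forall i, measurable (B i)) ->
    P [set w | forall i, B i (npoints Z (A i) w)] =
      (\prod_(i < n) P [set w | B i (npoints Z (A i) w)])%E
}.

(* The law of X, where X need only agree almost surely with a measurable map
   (the probability space is not assumed complete). *)
Definition has_law (X : Omega -> T) (nu : set T -> \bar R) : Prop :=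
  exists Y : {mfun Omega >-> T},
    {ae P, forall w, X w = Y w} /\
    forall B : set T, measurable B -> distribution P Y B = nu B.

End random.

Section plane.
Context (R : realType).

(* The product topology of R * R is the usual one, but its norm is the sup
   norm. *)
Definition enorm (x : R * R) : R := Num.sqrt (x.1 ^+ 2 + x.2 ^+ 2).

Definition dist0 (A : set (R * R)) : R := inf (enorm @` A).

Definition polar (r t : R) : R * R := (r * cos t, r * sin t).

Definition frontier (A : set (R * R)) : set (R * R) :=
  closure A `\` interior A.

Definition half_line (t : R) : set (R * R) :=
  [set polar s t | s in [set s | 0 < s]].

(* The representative of a modulo 2 pi in the interval ]t - pi, t + pi] . *)
Definition angle_around (t a : R) : R :=
  a - 2 * pi * (Num.ceil ((a - t - pi) / (2 * pi)))%:~R.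

End plane.

(* A marked point is z = (rho, theta, r). *)
Section marked_points.
Context (R : realType).
Local Notation mark := (measurableTypeR R * measurableTypeR R *
                        measurableTypeR R)%type.

Definition mark_rho (z : mark) : R := z.1.1.
Definition mark_theta (z : mark) : R := z.1.2.
Definition mark_radius (z : mark) : R := z.2.

Definition mark_space : set mark :=
  [set z | [/\ 0 <= mark_rho z, 0 <= mark_theta z < 2 * pi &
               0 <= mark_radius z]].

Definition intensity (mu : probability (measurableTypeR R) R) :
    set mark -> \bar R :=
  ((lebesgue_measure \x lebesgue_measure) \x mu)%E.

Definition line_of (z : mark) : set (R * R) :=
  [set x | x.1 * cos (mark_theta z) + x.2 * sin (mark_theta z) = mark_rho z].

Definition crofton_cell (S : set mark) : set (R * R) :=
  closure (connected_component (~` \bigcup_(z in S) line_of z) (0, 0)).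

Definition psi (lam rho r : R) : R :=
  r * Num.sqrt (1 + 2 * rho / (lam ^+ 2 * r)).

Definition disc_of (lam : R) (z : mark) : set (R * R) :=
  [set x | enorm (x - polar (psi lam (mark_rho z) (mark_radius z))
                            (mark_theta z)) < mark_radius z].

Definition disc_union (lam : R) (S : set mark) : set (R * R) :=
  \bigcup_(z in S) disc_of lam z.

Definition vacant_cell (lam : R) (S : set mark) : set (R * R) :=
  connected_component (~` disc_union lam S) (0, 0).

Definition rescaled_cell (K0 : set (R * R)) (lam : R) (S : set mark) :
    set (R * R) :=
  if `[< bounded_set (vacant_cell lam S) >]
  then [set (lam ^+ 2 * x.1, lam ^+ 2 * x.2) | x in vacant_cell lam S]
  else K0.

Definition defect (K0 : set (R * R)) (S : set mark) (lam t : R) : R :=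
  dist0 (half_line t `&` frontier (rescaled_cell K0 lam S)) -
  dist0 (half_line t `&` frontier (crofton_cell S)).

Definition edge_on (S : set mark) (z : mark) : set (R * R) :=
  crofton_cell S `&` line_of z.

(* The line of z supports an edge of the Crofton cell (it meets the cell in a
   nondegenerate segment), and the half-line in direction t meets that edge. *)
Definition supports_hit_edge (S : set mark) (t : R) (z : mark) : Prop :=
  [/\ S z,
      exists x y, [/\ edge_on S z x, edge_on S z y & x <> y] &
      half_line t `&` edge_on S z !=set0].

(* Almost surely exactly one marked point qualifies; (0, 0, 0) is the value
   chosen when there is none. *)
Definition hit_mark (S : set mark) (t : R) : mark :=
  xget ((0, 0, 0) : mark) (supports_hit_edge S t).

Definition Upsilon (S : set mark) (t : R) : R := mark_rho (hit_mark S t).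
Definition Theta (S : set mark) (t : R) : R := mark_theta (hit_mark S t).
Definition Radius (S : set mark) (t : R) : R := mark_radius (hit_mark S t).

Definition Lhit (S : set mark) (t : R) : R :=
  Upsilon S t / cos (Theta S t - t).

Definition Zlimit (S : set mark) (t : R) : R :=
  - (Lhit S t ^+ 2 / 2) *
  (cos (2 * (Theta S t - t)) / (Radius S t * cos (Theta S t - t))).

Definition hit_triple (S : set mark) (t : R) : mark :=
  (Lhit S t, angle_around t (Theta S t), Radius S t).

(* The measure exp (- 2 l) cos (a - t) 1_(|a - t| < pi / 2) dl da dmu(r) on
   l > 0, evaluated at B. *)
Definition hit_law (mu : probability (measurableTypeR R) R) (t : R)
    (B : set mark) : \bar R :=
  (\int[(lebesgue_measure \x lebesgue_measure) \x mu]_(x in B)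
     (expR (- 2 * x.1.1) * cos (x.1.2 - t)
      * \1_(`]t - pi / 2, t + pi / 2[%classic : set R) x.1.2
      * \1_(`]0, +oo[%classic : set R) x.1.1)%:E)%E.

End marked_points.

(* Main.v *)
Require Import Defs.
From HB Require Import structures.
From mathcomp Require Import all_boot all_order all_algebra.
From mathcomp Require Import all_classical all_reals all_analysis.
From mathcomp Require Import measurable_realfun.
From mathcomp Require Import ring lra.
From mathcomp Require finmap.
Import Order.TTheory GRing.Theory Num.Theory.
Import numFieldNormedType.Exports.
Local Open Scope classical_set_scope.
Local Open Scope ring_scope.

Set Implicit Arguments.
Unset Strict Implicit.
Unset Printing Implicit Defensive.

(** Everything takes place along the ray in direction [t], where the line of a
    mark [z] is met at the abscissa [reach t z], the distance to the line
    divided by the cosine of the angle between its normal and the ray.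

    Geometry, for a fixed configuration. The Crofton cell is the intersection
    of the closed half-planes that contain the origin and are bounded by the
    lines ([crofton_cellE]), so that the ray leaves it at the smallest abscissa
    and the hit mark is the one realizing it ([hit_markE], [dist0_crofton]). In
    the scale of the Crofton cell, a disc of the coupled model is the set where
    [power] is negative; it converges to the half-plane beyond the line of its
    mark. For large [lam] only finitely many discs matter, because the radii are
    bounded below ([power_far]), and the first disc met by the ray is that of
    the hit mark: the ray leaves the vacant cell at the smaller root [entry] of
    a quadratic equation ([near_defect]). The vacant cell is bounded since the
    discs cover the boundary of a square around the origin
    ([near_bounded_vacant]).
    Expanding the root to second order gives the limit ([cvg_entry_defect]).

    Probability. The marks whose abscissa is in [`]a, b]] and whose angle and
    radius are in [G] have intensity [(b - a) * weight G] ([intensity_cell]), and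
    the weight of the whole space is [2] ([weightT]). Cut [`]0, s]] into equal
    steps; the first occupied step contains a mark of [G] with probability at
    most about [weight G / 2 * (1 - expR (- 2 * s))]
    ([probability_limit_event_le]). The events obtained in the limit for [G] and
    for its complement cover the event that some line is met before [s], whose
    probability [1 - expR (- 2 * s)] is the sum of the two bounds. Hence both
    bounds are attained and the two events are almost surely disjoint
    ([limit_event_law]). Disjointness, for countably many [G], excludes ties
    ([ae_first_hit]); equality gives the joint law on a generating pi-system
    ([hit_law_unique], [hit_triple_law]). *)

(** * Connected components and rays in the plane *)

Section planar_topology.
Context (R : realType).
Implicit Types (A B : set (R * R)) (x y : R * R).

Lemma near_finite (T : Type) (I : choiceType) (F : set_system T)
    (FF : Filter F) (A : set I) (Q : I -> T -> Prop) : finite_set A ->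
  (forall i, A i -> \forall x \near F, Q i x) ->
  \forall x \near F, forall i, A i -> Q i x.
Proof.
move=> /finite_fsetP[D ->] h.
apply: filterS (@filter_bigI T I D Q F FF _) => [x /= + i iD|i iD]; first exact.
exact: h.
Qed.

Lemma segment_component A x y :
  (forall s : R, 0 <= s <= 1 -> A (x + s *: (y - x))) ->
  connected_component A x y.
Proof.
move=> h; pose f (s : R) := x + s *: (y - x).
have fc : continuous f.
  move=> s; apply: cvgD; first exact: cvg_cst.
  by apply: cvgZr_tmp; exact: cvg_id.
have f0 : f 0 = x by rewrite /f scale0r addr0.
have f1 : f 1 = y by rewrite /f scale1r subrKC.
exists (f @` `[0, 1]%classic); last first.
  by exists 1 => //; rewrite /= in_itv/= lexx ler01.
split.
- by exists 0 => //; rewrite /= in_itv/= lexx ler01.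
- by move=> _ [s + <-]; rewrite /= in_itv/= => /h.
- apply: connected_continuous_connected.
    exact/connected_intervalP/interval_is_interval.
  exact: continuous_subspaceT.
Qed.

(** The image of a connected set is an interval, so that a continuous function
    cannot cross on it a value that it avoids. *)
Lemma component_barrier A x y (g : R * R -> R) (c : R) : continuous g ->
  (forall z, A z -> g z != c) -> connected_component A x y -> g x < c ->
  g y < c.
Proof.
move=> gc gA [B [Bx BA Bc] By] gx; rewrite ltNge; apply/negP => gy.
have /connected_intervalP gB : connected (g @` B).
  by apply: connected_continuous_connected => //; exact: continuous_subspaceT.
have [] := gB (g x) (g y) _ _ c; [by exists x|by exists y| |].
  by rewrite (ltW gx) gy.
by move=> z /BA /gA /eqP.
Qed.

Lemma near_component A x y : connected_component A x y ->
  (\forall z \near y, A z) -> \forall z \near y, connected_component A x z.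
Proof.
move=> xy /nbhs_ballP[e /= e0 ball_A].
apply/nbhs_ballP; exists e => //= z yz.
apply: connected_component_trans xy _; apply: segment_component => s /andP[s0 s1].
apply: ball_A; rewrite -ball_normE/= opprD addrA subrr add0r normrN normrZ.
rewrite ger0_norm//; move: yz; rewrite -ball_normE/= distrC => yz.
by rewrite (le_lt_trans _ yz)// ler_piMl.
Qed.

Lemma enorm_polar (s t : R) : 0 <= s -> enorm (polar s t) = s.
Proof.
move=> s0; rewrite /enorm/= !exprMn -mulrDr cos2Dsin2 mulr1.
by rewrite sqrtr_sqr ger0_norm.
Qed.

Lemma continuous_polar (t : R) : continuous (fun s => polar s t).
Proof.
move=> s; apply: (@cvg_pair _ _ _ _ (nbhs (s * cos t)) (nbhs (s * sin t)));
  by apply: cvgMr_tmp; exact: cvg_id.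
Qed.

(** The infimum defining the distance is attained at the first exit point:
    nothing before it belongs to the frontier, and later points of the ray are
    farther from the origin. *)
Lemma dist0_first_exit A (t s0 eta : R) : 0 < s0 -> 0 < eta ->
  (forall s : R, 0 <= s < s0 -> interior A (polar s t)) ->
  (forall s : R, s0 < s < s0 + eta -> ~ A (polar s t)) ->
  dist0 (half_line t `&` frontier A) = s0.
Proof.
move=> s00 eta0 inA outA.
have exit_pt : (half_line t `&` frontier A) (polar s0 t).
  split; first by exists s0.
  split.
    move=> B nB.
    have : \forall s \near s0^'-, B (polar s t) /\ 0 <= s < s0.
      near=> s; split.
        near: s; exact: (cvg_at_left_filter (@continuous_polar t s0) nB).
      apply/andP; split; near: s; first exact: nbhs_left_ge.
      exact: nbhs_left_lt.
    move=> h; have [s [Bs lts]] := @filter_ex _ _ (at_left_proper_filter s0) _ h.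
    by exists (polar s t); split => //; exact: interior_subset (inA s lts).
  move=> inA0.
  have : \forall s \near s0^'+, A (polar s t) /\ s0 < s < s0 + eta.
    near=> s; split.
      by near: s; exact: (cvg_at_right_filter (@continuous_polar t s0) inA0).
    apply/andP; split; near: s; first exact: nbhs_right_gt.
    by apply: nbhs_right_lt; rewrite ltrDl.
  by move=> h; have [s [As lts]] := @filter_ex _ _ (at_right_proper_filter s0) _ h; exact: outA As.
apply/eqP; rewrite eq_le; apply/andP; split.
  apply: ge_inf; first by exists 0 => _ [x _ <-]; exact: sqrtr_ge0.
  by exists (polar s0 t) => //; rewrite enorm_polar ?ltW.
apply: lb_le_inf; first by exists (enorm (polar s0 t)), (polar s0 t).
move=> _ [_ [[s /= s_gt0 <-] [_ nint]] <-]; rewrite (enorm_polar _ (ltW s_gt0)).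
have [//|lt_s] := leP s0 s; exfalso; apply: nint; apply: inA.
by rewrite lt_s (ltW s_gt0).
Unshelve. all: by end_near. Qed.

End planar_topology.

(** * The Crofton cell along a ray *)

Section crofton.
Context (R : realType).
Local Notation mark := (measurableTypeR R * measurableTypeR R *
                        measurableTypeR R)%type.
Implicit Types (S : set mark) (z : mark) (x y : R * R) (t : R).

Definition dotu z x : R := x.1 * cos (mark_theta z) + x.2 * sin (mark_theta z).

(** The abscissa of the intersection of the line of [z] with the ray in
    direction [t]; meaningful only when the cosine is positive. *)
Definition reach t z : R := mark_rho z / cos (mark_theta z - t).

Definition locally_finite S :=
  forall M : R, finite_set [set z | S z /\ mark_rho z <= M].

Definition first_hit S t z :=
  [/\ S z, 0 < cos (mark_theta z - t) &
      forall z', S z' -> z' <> z -> 0 < cos (mark_theta z' - t) ->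
        reach t z < reach t z'].

Lemma dotu_polar z (s t : R) : dotu z (polar s t) = s * cos (mark_theta z - t).
Proof. rewrite /dotu /polar /= cosB; ring. Qed.

Lemma dotuD z x y : dotu z (x + y) = dotu z x + dotu z y.
Proof. rewrite /dotu /=; ring. Qed.

Lemma dotuZ z (s : R) x : dotu z (s *: x) = s * dotu z x.
Proof. by rewrite /dotu /= mulrDr -!mulrA. Qed.

Lemma dotu0 z : dotu z (0, 0) = 0.
Proof. by rewrite /dotu /= !mul0r addr0. Qed.

Lemma continuous_dotu z : continuous (dotu z).
Proof.
move=> x; apply: cvgD; apply: cvgMr_tmp; first exact: cvg_fst.
exact: cvg_snd.
Qed.

Lemma norm_pair_le x : `|x.1| <= `|x| /\ `|x.2| <= `|x|.
Proof. by split; rewrite prod_normE le_max lexx ?orbT. Qed.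

Lemma dotu_le z x : dotu z x <= 2 * `|x|.
Proof.
have [h1 h2] := norm_pair_le x.
have := cos_max (mark_theta z); have := sin_max (mark_theta z) => hs hc.
rewrite /dotu (le_trans (ler_norm _))// (le_trans (ler_normD _ _))// !normrM.
by rewrite mulr2n mulrDl !mul1r lerD// -[leRHS]mulr1 ler_pM.
Qed.

Lemma near_below_lines S x : locally_finite S ->
  (forall z, S z -> dotu z x < mark_rho z) ->
  \forall y \near x, forall z, S z -> dotu z y < mark_rho z.
Proof.
move=> finS ltx.
(* Lines farther than [2 * (`|x| + 1)] cannot be reached from near [x]. *)
have near_fin : \forall y \near x, forall z,
    S z /\ mark_rho z <= 2 * (`|x| + 1) -> dotu z y < mark_rho z.
  apply: (@near_finite _ _ (nbhs x) _ _ (fun z y => dotu z y < mark_rho z)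
    (finS _)) => z [Sz _].
  exact: (cvgr_lt _ (@continuous_dotu z x) _ (ltx z Sz)).
have near_norm : \forall y \near x, `|y| < `|x| + 1.
  by apply: (cvgr_lt _ (@norm_continuous _ _ x)); rewrite ltrDl.
near=> y => z Sz.
have [le_rho|lt_rho] := leP (mark_rho z) (2 * (`|x| + 1)).
  by apply: (near near_fin y).
apply: le_lt_trans lt_rho; apply: le_trans (dotu_le z y) _.
by rewrite ler_pM2l ?ltr0n// ltW//; near: y.
Unshelve. all: by end_near. Qed.

(** Segments from the origin stay in the open half-planes, and a connected set
    that avoids a line remains on one side of it. *)
Lemma open_croftonE S : (forall z, S z -> 0 < mark_rho z) ->
  connected_component (~` \bigcup_(z in S) line_of z) (0, 0) =
  [set x | forall z, S z -> dotu z x < mark_rho z].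
Proof.
move=> rho0; apply/seteqP; split=> x /=.
  move=> comp z Sz.
  apply: component_barrier comp _; first exact: continuous_dotu.
    by move=> y nline; apply/eqP => yz; apply: nline; exists z.
  by rewrite dotu0; exact: rho0.
move=> ltx; apply: segment_component => s /andP[s0 s1] [z Sz] /=.
apply/eqP; rewrite -/(dotu z _) lt_eqF// dotuD dotuZ dotuD dotu0 add0r.
rewrite (_ : - _ = (-1 : R) *: (0, 0)); last by rewrite scaleN1r.
rewrite dotuZ dotu0 mulr0 addr0.
have [d0|d0] := leP (dotu z x) 0.
  by rewrite (le_lt_trans _ (rho0 _ Sz))// mulr_ge0_le0.
by rewrite (le_lt_trans _ (ltx _ Sz))// ler_piMl// ltW.
Qed.

(** A point of the closed half-planes is a limit of its contractions towards
    the origin, which are in the open ones. *)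
Lemma crofton_cellE S : (forall z, S z -> 0 < mark_rho z) ->
  crofton_cell S = [set x | forall z, S z -> dotu z x <= mark_rho z].
Proof.
move=> rho0; rewrite /crofton_cell open_croftonE//; apply/seteqP; split=> x /=.
  move=> clx z Sz; rewrite leNgt; apply/negP => gtx.
  have /clx[y [/(_ _ Sz)/= lty]] : nbhs x [set y | mark_rho z < dotu z y].
    exact: (cvgr_gt _ (@continuous_dotu z x) _ gtx).
  by move=> /(lt_trans lty); rewrite ltxx.
move=> lex B Bx.
have cx : (fun s : R => s *: x) s @[s --> (1 : R)^'-] --> x.
  rewrite -[X in _ --> X]scale1r; apply: cvg_at_left_filter.
  by apply: cvgZr_tmp; exact: cvg_id.
have h : \forall s \near (1 : R)^'-, B (s *: x) /\ 0 < s < 1.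
  near=> s; split; first by near: s; exact: cx.
  by apply/andP; split; near: s; [exact: nbhs_left_gt|exact: nbhs_left_lt].
have [s [Bs /andP[s0 s1]]] := @filter_ex _ _ (at_left_proper_filter 1) _ h.
exists (s *: x); split=> // z Sz; rewrite dotuZ.
rewrite (@le_lt_trans _ _ (s * mark_rho z))// ?ler_pM2l ?lex//.
by rewrite gtr_pMl ?rho0.
Unshelve. all: by end_near. Qed.

Section hit.
Variables (S : set mark) (t : R) (zh : mark).
Hypotheses (rho_gt0 : forall z, S z -> 0 < mark_rho z)
  (finS : locally_finite S) (hit_zh : first_hit S t zh).

Lemma reach_gt0 : 0 < reach t zh.
Proof. by case: hit_zh => Sz c0 _; rewrite divr_gt0 ?rho_gt0. Qed.

Lemma dotu_hit (s : R) : dotu zh (polar s t) =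
  s / reach t zh * mark_rho zh.
Proof.
case: hit_zh => Sz c0 _; rewrite dotu_polar /reach invf_div.
by rewrite -[RHS]mulrA divfK ?gt_eqF ?rho_gt0.
Qed.

Lemma below_others (s : R) z : 0 <= s <= reach t zh -> S z -> z <> zh ->
  dotu z (polar s t) < mark_rho z.
Proof.
move=> /andP[s0 sL] Sz nz; rewrite dotu_polar.
have [c0|c0] := leP (cos (mark_theta z - t)) 0.
  by rewrite (le_lt_trans _ (rho_gt0 Sz))// mulr_ge0_le0.
rewrite -ltr_pdivlMr//; apply: le_lt_trans sL _.
by case: hit_zh => _ _; apply.
Qed.

Lemma below_all (s : R) z : 0 <= s < reach t zh -> S z ->
  dotu z (polar s t) < mark_rho z.
Proof.
move=> /andP[s0 sL] Sz; have [->|/eqP nz] := eqVneq z zh; last first.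
  by apply: below_others => //; rewrite s0 ltW.
case: hit_zh => Szh _ _.
by rewrite dotu_hit gtr_pMl ?rho_gt0// ltr_pdivrMr ?mul1r// reach_gt0.
Qed.

Lemma dist0_crofton :
  dist0 (half_line t `&` frontier (crofton_cell S)) = reach t zh.
Proof.
apply: (@dist0_first_exit _ _ _ _ 1) => //; first exact: reach_gt0.
- move=> s sL; rewrite crofton_cellE// /interior.
  have := near_below_lines finS (fun z Sz => below_all sL Sz).
  by apply: filterS => y lty z Sz; rewrite ltW// lty.
- case: hit_zh => Szh _ _.
  move=> s /andP[sL _]; rewrite crofton_cellE// => /(_ _ Szh).
  rewrite dotu_hit leNgt => /negP; apply.
  by rewrite ltr_pMl ?rho_gt0// ltr_pdivlMr ?mul1r// reach_gt0.
Qed.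

(** Uniqueness is the main point: a line meeting the cell on the ray meets the
    ray no later than the cell ends, hence is the first line. Conversely the
    first line does support an edge, because the other lines stay away from
    the hitting point. *)
Lemma hit_markE : hit_mark S t = zh.
Proof.
have L0 := reach_gt0; case: (hit_zh) => Szh c0 hmin.
have on_line (s : R) z : line_of z (polar s t) = (s * cos (mark_theta z - t) = mark_rho z).
  by rewrite -dotu_polar.
rewrite /hit_mark; apply: xget_unique; last first.
  move=> z [Sz _ [x [[s /= s0 <-] []]]].
  rewrite crofton_cellE// on_line => /(_ _ Szh).
  rewrite dotu_hit -ler_pdivlMr ?rho_gt0// divff ?gt_eqF ?rho_gt0//.
  rewrite ler_pdivrMr// mul1r => sL sz.
  have [//|/eqP nz] := eqVneq z zh; exfalso.
  have : dotu z (polar s t) < mark_rho z by apply: below_others => //; rewrite sL ltW.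
  by rewrite dotu_polar sz ltxx.
set L := reach t zh in L0 *.
have onL : edge_on S zh (polar L t).
  split; last by rewrite on_line /L /reach divfK ?gt_eqF.
  rewrite crofton_cellE// => z Sz; have [->|/eqP nz] := eqVneq z zh.
    by rewrite dotu_hit divff ?mul1r// gt_eqF.
  by rewrite ltW// below_others// lexx ltW.
split=> //; last by exists (polar L t); split=> //; exists L.
(* The edge also contains a neighbour of the hitting point, obtained by moving
   along the line. *)
pose v : R * R := (- sin (mark_theta zh), cos (mark_theta zh)).
have vE : dotu zh v = 0 by rewrite /dotu /v/=; ring.
have v0 : v != 0.
  apply/negP => /eqP [] /eqP; rewrite oppr_eq0 => /eqP sz cz.
  have := cos2Dsin2 (mark_theta zh); rewrite sz cz expr0n/= addr0 => /eqP.
  by rewrite eq_sym oner_eq0.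
have finS' : locally_finite (S `\ zh).
  by move=> M; apply: sub_finite_set (finS M) => z [[]].
have cy : (fun s : R => polar L t + s *: v) s @[s --> (0 : R)^'+] --> polar L t.
  rewrite [X in _ --> X](_ : _ = polar L t + 0 *: v); last first.
    by rewrite scale0r addr0.
  apply: cvg_at_right_filter; apply: cvgD; first exact: cvg_cst.
  by apply: cvgZr_tmp; exact: cvg_id.
have below z : (S `\ zh) z -> dotu z (polar L t) < mark_rho z.
  by move=> [Sz nz]; apply: below_others; rewrite ?lexx ?ltW.
have h : \forall s \near (0 : R)^'+,
    (forall z, (S `\ zh) z -> dotu z (polar L t + s *: v) < mark_rho z) /\ 0 < s.
  near=> s; split; last by near: s; exact: nbhs_right_gt.
  by near: s; apply: (cy _ (near_below_lines finS' below)).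
have [s [lts s0]] := @filter_ex _ _ (at_right_proper_filter 0) _ h.
exists (polar L t), (polar L t + s *: v); split=> //; last first.
  move=> /eqP; rewrite -subr_eq0 opprD addrA subrr add0r oppr_eq0 scaler_eq0.
  by rewrite (negPf v0) orbF gt_eqF.
have dE : dotu zh (polar L t + s *: v) = mark_rho zh.
  by rewrite dotuD dotuZ vE mulr0 addr0 dotu_hit divff ?mul1r ?gt_eqF.
split=> //; rewrite crofton_cellE// => z Sz.
have [->|/eqP nz] := eqVneq z zh; first by rewrite dE.
by rewrite ltW// lts.
Unshelve. all: by end_near. Qed.

End hit.
End crofton.

(** * The discs along a ray *)

Section discs.
Context (R : realType).
Local Notation mark := (measurableTypeR R * measurableTypeR R *
                        measurableTypeR R)%type.
Implicit Types (S : set mark) (z : mark) (x y : R * R) (t lam : R).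

(** The power, up to a factor [lam ^- 2], of the point [lam ^- 2 *: y] with
    respect to the circle bounding the disc of [z]. As [lam] grows it tends to
    [2 * mark_radius z * (mark_rho z - dotu z y)]: the disc becomes the
    half-plane beyond the line of [z]. *)
Definition power lam z y : R :=
  (y.1 ^+ 2 + y.2 ^+ 2) / lam ^+ 2
  - 2 * psi lam (mark_rho z) (mark_radius z) * dotu z y
  + 2 * mark_rho z * mark_radius z.

Section psi_facts.
Variables (lam rho r : R).
Hypotheses (lam_gt0 : 0 < lam) (rho_gt0 : 0 < rho) (r_gt0 : 0 < r).

Lemma psi_arg_ge1 : 1 <= 1 + 2 * rho / (lam ^+ 2 * r).
Proof. by rewrite lerDl divr_ge0// ?mulr_ge0 ?ltW// mulr_gt0 ?exprn_gt0. Qed.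

Lemma psi_sqr : psi lam rho r ^+ 2 = r ^+ 2 + 2 * rho * r / lam ^+ 2.
Proof.
rewrite /psi exprMn sqr_sqrtr; last by rewrite (le_trans ler01)// psi_arg_ge1.
by field; rewrite !gt_eqF.
Qed.

Lemma psi_ge : r <= psi lam rho r.
Proof.
rewrite /psi ler_peMr ?(ltW r_gt0)// -[leLHS]sqrtr1 ler_wsqrtr//.
exact: psi_arg_ge1.
Qed.

Lemma psi_gt0 : 0 < psi lam rho r.
Proof. exact: lt_le_trans r_gt0 psi_ge. Qed.

End psi_facts.

Lemma enorm_sqr x : enorm x ^+ 2 = x.1 ^+ 2 + x.2 ^+ 2.
Proof. by rewrite /enorm sqr_sqrtr// addr_ge0 ?sqr_ge0. Qed.

Lemma disc_ofE lam z y : 0 < lam -> 0 < mark_rho z -> 0 < mark_radius z ->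
  disc_of lam z (lam ^- 2 *: y) <-> power lam z y < 0.
Proof.
move=> l0 rho0 r0; rewrite /disc_of /=.
rewrite -(ltr_pXn2r (n := 2))// ?nnegrE ?sqrtr_ge0 ?ltW//.
rewrite enorm_sqr -subr_lt0 -(pmulr_rlt0 _ (exprn_gt0 2 l0)).
suff -> : lam ^+ 2 * (((lam ^- 2 *: y) - polar (psi lam (mark_rho z)
      (mark_radius z)) (mark_theta z)).1 ^+ 2 + ((lam ^- 2 *: y) - polar (psi lam
      (mark_rho z) (mark_radius z)) (mark_theta z)).2 ^+ 2 - mark_radius z ^+ 2)
    = power lam z y by [].
have psi2 := psi_sqr l0 rho0 r0; rewrite /power /dotu /=.
set p := psi _ _ _ in psi2 *.
have cs := cos2Dsin2 (mark_theta z).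
transitivity ((y.1 ^+ 2 + y.2 ^+ 2) / lam ^+ 2
   - 2 * p * (y.1 * cos (mark_theta z) + y.2 * sin (mark_theta z))
   + lam ^+ 2 * (p ^+ 2 * (cos (mark_theta z) ^+ 2 + sin (mark_theta z) ^+ 2)
     - mark_radius z ^+ 2)).
  by rewrite /GRing.scale/=; field; rewrite gt_eqF.
rewrite cs psi2; congr (_ + _); field; rewrite gt_eqF//.
Qed.

Lemma continuous_power lam z : continuous (power lam z).
Proof.
move=> y; apply: cvgD; last exact: cvg_cst.
apply: cvgB; last by apply: cvgMl_tmp; exact: continuous_dotu.
by apply: cvgMr_tmp; apply: cvgD; rewrite expr2; apply: cvgM;
  (exact: cvg_fst || exact: cvg_snd).
Qed.

Lemma power_polar lam z (s t : R) : power lam z (polar s t) =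
  s ^+ 2 / lam ^+ 2
  - 2 * psi lam (mark_rho z) (mark_radius z) * cos (mark_theta z - t) * s
  + 2 * mark_rho z * mark_radius z.
Proof.
rewrite /power dotu_polar /= !exprMn -mulrDr cos2Dsin2 mulr1.
by congr (_ - _ + _); ring.
Qed.

Lemma dotu_sqr_le z y : dotu z y ^+ 2 <= y.1 ^+ 2 + y.2 ^+ 2.
Proof.
rewrite -[leRHS]mulr1 -(cos2Dsin2 (mark_theta z)) -subr_ge0.
rewrite (_ : _ - _ = (y.1 * sin (mark_theta z) - y.2 * cos (mark_theta z)) ^+ 2).
  exact: sqr_ge0.
by rewrite /dotu; ring.
Qed.

(** Far marks produce discs that stay away from a fixed ball, uniformly in
    [lam >= 1]: this is where a positive lower bound on the radii matters. *)
Lemma power_far (Rstar K lam : R) z y : 0 < Rstar -> 0 < K -> 1 <= lam ->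
  Rstar < mark_radius z -> K + 2 * K ^+ 2 / Rstar < mark_rho z ->
  y.1 ^+ 2 + y.2 ^+ 2 <= K ^+ 2 -> 0 <= power lam z y.
Proof.
rewrite /power; set r := mark_radius z; set rho := mark_rho z.
move=> Rs0 K0 l1 rRs rhoK yK.
have l0 : 0 < lam by exact: lt_le_trans l1.
have r0 : 0 < r by exact: lt_trans rRs.
have rho0 : 0 < rho.
  apply: lt_trans rhoK; rewrite addr_gt0// divr_gt0// mulr_gt0// exprn_gt0//.
have p0 := psi_gt0 l0 rho0 r0; have := psi_sqr l0 rho0 r0.
set p := psi _ _ _ in p0 *; clearbody p => psi2.
have dK : dotu z y <= K.
  rewrite (le_trans (ler_norm _))// -(ler_pXn2r (n := 2)) ?nnegrE ?(ltW K0)//.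
  by rewrite real_normK ?num_real// (le_trans (dotu_sqr_le z y)).
have psi2_le : p ^+ 2 <= r ^+ 2 + 2 * rho * r.
  rewrite psi2 lerD2l ler_pdivrMr ?exprn_gt0//.
  by rewrite ler_peMr ?exprn_ege1// ltW// !mulr_gt0.
have pK : p * K <= rho * r.
  have pK0 := ltW (mulr_gt0 p0 K0); have rr0 := ltW (mulr_gt0 rho0 r0).
  rewrite -(ler_pXn2r (n := 2)) ?nnegrE//.
  rewrite !exprMn (le_trans (ler_wpM2r (sqr_ge0 K) psi2_le))//.
  have rhoRs : K * Rstar + 2 * K ^+ 2 <= rho * Rstar.
    rewrite -ler_pdivrMr// mulrDl mulfK ?gt_eqF// ltW//.
  suff h : K ^+ 2 * (r + 2 * rho) <= rho ^+ 2 * r.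
    rewrite (_ : (_ + _) * _ = K ^+ 2 * (r + 2 * rho) * r); last by ring.
    rewrite (_ : _ * r ^+ 2 = rho ^+ 2 * r * r); last by ring.
    by rewrite ler_pM2r.
  have Krho : K <= rho.
    by rewrite ltW// (le_lt_trans _ rhoK)// lerDl divr_ge0 ?mulr_ge0 ?ltW// exprn_gt0.
  have h1 : K * r + 2 * K ^+ 2 <= rho * r.
    rewrite -lerBrDl -mulrBl (le_trans (_ : _ <= (rho - K) * Rstar))//.
      by rewrite mulrBl lerBrDl.
    by rewrite ler_wpM2l ?subr_ge0// ltW.
  apply: (@le_trans _ _ (rho * (K * r + 2 * K ^+ 2))); last first.
    by rewrite expr2 -mulrA ler_pM2l.
  rewrite (_ : K ^+ 2 * _ = K * (K * r) + rho * (2 * K ^+ 2)); last by ring.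
  by rewrite mulrDr lerD2r ler_wpM2r// mulr_ge0 ?ltW.
rewrite addrAC -addrA; apply: addr_ge0.
  by rewrite divr_ge0 ?addr_ge0 ?sqr_ge0.
rewrite subr_ge0 -!mulrA ler_pM2l// (le_trans _ pK)//.
by rewrite ler_pM2l.
Qed.

Section cell.
Variables (lam : R) (S : set mark).
Hypotheses (lam_gt0 : 0 < lam) (rho_gt0 : forall z, S z -> 0 < mark_rho z)
  (rad_gt0 : forall z, S z -> 0 < mark_radius z).

Lemma vacantP y : (~` disc_union lam S) (lam ^- 2 *: y) <->
  (forall z, S z -> 0 <= power lam z y).
Proof.
split=> [nd z Sz|h [z Sz] dz].
  rewrite leNgt; apply/negP => pz; apply: nd; exists z => //.
  by apply/disc_ofE => //; [exact: rho_gt0|exact: rad_gt0].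
have /disc_ofE := dz => /(_ lam_gt0 (rho_gt0 Sz) (rad_gt0 Sz)).
by rewrite ltNge h.
Qed.

Lemma scaleK y : lam ^- 2 *: (lam ^+ 2 *: y) = y.
Proof. by rewrite scalerA mulVf ?scale1r// gt_eqF ?exprn_gt0. Qed.

Lemma scaleVK y : lam ^+ 2 *: (lam ^- 2 *: y) = y.
Proof. by rewrite scalerA mulfV ?scale1r// gt_eqF ?exprn_gt0. Qed.

(** A closed curve covered by discs around the origin confines the vacant
    component; the curve is a square, the norm of the product being the
    sup norm. *)
Lemma bounded_vacant (M : R) : 0 < M ->
  (forall y, `|y| = M -> exists2 z, S z & power lam z y < 0) ->
  bounded_set (vacant_cell lam S).
Proof.
move=> M0 cover.
exists (M / lam ^+ 2); split; first exact: num_real.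
move=> B MB x xV; apply: le_trans (ltW MB); apply: ltW.
apply: (component_barrier (@norm_continuous _ _) _ xV).
  move=> y yV; apply/eqP => ny.
  have [|z Sz] := cover (lam ^+ 2 *: y).
    by rewrite normrZ ny ger0_norm ?exprn_ge0 ?ltW// mulrCA mulfV ?mulr1// gt_eqF ?exprn_gt0.
  rewrite ltNge => /negP; apply.
  by move: yV; rewrite -{1}(scaleK y) => /vacantP; apply.
have -> : (0, 0) = 0 :> R * R by [].
by rewrite normr0 divr_gt0 ?exprn_gt0.
Qed.

Lemma rescaled_cellE (K0 : set (R * R)) : bounded_set (vacant_cell lam S) ->
  rescaled_cell K0 lam S = (fun y => lam ^- 2 *: y) @^-1` vacant_cell lam S.
Proof.
move=> bd; rewrite /rescaled_cell asboolT//; apply/seteqP; split => y /=.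
  by move=> [x xV <-]; rewrite -[(_, _)]/(lam ^+ 2 *: x) scaleK.
by move=> yV; exists (lam ^- 2 *: y) => //; exact: scaleVK.
Qed.

Lemma dist0_rescaled (K0 : set (R * R)) (t s0 eta : R) zh :
  bounded_set (vacant_cell lam S) -> 0 < s0 -> 0 < eta -> S zh ->
  (forall s z, 0 <= s <= s0 -> S z -> 0 <= power lam z (polar s t)) ->
  (forall s, 0 <= s < s0 ->
     \forall y \near polar s t, forall z, S z -> 0 <= power lam z y) ->
  (forall s, s0 < s < s0 + eta -> power lam zh (polar s t) < 0) ->
  dist0 (half_line t `&` frontier (rescaled_cell K0 lam S)) = s0.
Proof.
move=> bd s00 eta0 Szh pos near_pos neg.
rewrite rescaled_cellE//; apply: (dist0_first_exit (eta := eta)) => //.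
  move=> s lts; rewrite /interior.
  have comp : vacant_cell lam S (lam ^- 2 *: polar s t).
    apply: segment_component => u /andP[u0 u1].
    have -> : (0, 0) + u *: (lam ^- 2 *: polar s t - (0, 0)) =
              lam ^- 2 *: polar (u * s) t :> R * R.
      have -> : (0, 0) = 0 :> R * R by [].
      rewrite add0r subr0 scalerA mulrC -scalerA; congr (_ *: _).
      by rewrite /polar -!mulrA.
    apply/vacantP => z Sz; apply: pos => //; case/andP: lts => ge0 lts.
    by rewrite mulr_ge0//= (le_trans _ (ltW lts))// ler_piMl.
  have c1 : (fun y : R * R => lam ^- 2 *: y) @ polar s t --> lam ^- 2 *: polar s t.
    by apply: cvgZl_tmp; exact: cvg_id.
  have c2 : (fun y : R * R => lam ^+ 2 *: y) @ (lam ^- 2 *: polar s t) --> polar s t.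
    rewrite -[X in _ --> X]scaleVK; by apply: cvgZl_tmp; exact: cvg_id.
  apply: c1; apply: near_component comp _.
  have near_x : \forall x \near lam ^- 2 *: polar s t,
      forall z, S z -> 0 <= power lam z (lam ^+ 2 *: x).
    exact: (c2 _ (near_pos s lts)).
  apply: filterS near_x => x h.
  by have /vacantP := h; rewrite scaleK.
move=> s lts /= /connected_component_sub /vacantP /(_ _ Szh).
by rewrite leNgt neg.
Qed.

End cell.
End discs.

(** * Asymptotics of the defect for a fixed configuration *)

Section asymptotics.
Context (R : realType).
Local Notation mark := (measurableTypeR R * measurableTypeR R *
                        measurableTypeR R)%type.
Implicit Types (S : set mark) (z : mark) (x y : R * R) (t lam : R).

(** The points of [S] surround the origin: every direction is within a fixed
    angle of the direction of one of boundedly far points. *)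
Definition surrounded S := exists M : R, forall y : R * R,
  exists z, [/\ S z, mark_rho z <= M & `|y| <= 2 * dotu z y].

Lemma cvg_inv_sqr : lam ^- 2 @[lam --> +oo] --> (0 : R).
Proof.
apply/cvgr0Pnorm_lt => e e0.
near=> lam.
have l1 : 1 <= lam by near: lam; exact: nbhs_pinfty_ge.
have le : e^-1 < lam by near: lam; apply: nbhs_pinfty_gt; exact: num_real.
have l0 : 0 < lam by exact: lt_le_trans l1.
rewrite ger0_norm ?invr_ge0 ?exprn_ge0 ?(ltW l0)//.
rewrite -[ltRHS]invrK ltf_pV2 ?posrE ?invr_gt0 ?exprn_gt0//.
by rewrite (lt_le_trans le)// expr2 ler_peMr// ltW.
Unshelve. all: by end_near. Qed.

Lemma cvg_psi (rho r : R) : 0 < r -> psi lam rho r @[lam --> +oo] --> r.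
Proof.
move=> r0; rewrite -[X in _ --> X]mulr1; apply: cvgMl_tmp.
rewrite -[X in _ --> X]sqrtr1.
apply: continuous_cvg; first exact: sqrt_continuous.
rewrite -[X in _ --> X]addr0; apply: cvgD; first exact: cvg_cst.
rewrite -[X in _ --> X](mulr0 (2 * rho / r)).
under eq_fun do rewrite invfM mulrA mulrAC.
by apply: cvgMl_tmp; exact: cvg_inv_sqr.
Qed.

Section fixed_mark.
Variables (rho r c : R).
Hypotheses (rho_gt0 : 0 < rho) (r_gt0 : 0 < r) (c_gt0 : 0 < c).

(** [c * psi] is the abscissa of the projection of the centre on the ray, and
    [half_chord] half the length of the chord cut on it by the disc. *)
Definition half_chord lam : R :=
  Num.sqrt ((psi lam rho r * c) ^+ 2 - 2 * rho * r / lam ^+ 2).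

(** The rescaled abscissa at which the ray enters the disc. *)
Definition entry lam : R := lam ^+ 2 * (psi lam rho r * c - half_chord lam).

Lemma cvg_psic : psi lam rho r * c @[lam --> +oo] --> r * c.
Proof. by apply: cvgMr_tmp; exact: cvg_psi. Qed.

Lemma cvg_radicand :
  (psi lam rho r * c) ^+ 2 - 2 * rho * r / lam ^+ 2 @[lam --> +oo]
    --> (r * c) ^+ 2.
Proof.
rewrite -[X in _ --> X]subr0 -[X in _ - X](mulr0 (2 * rho * r)).
apply: cvgB; last by apply: cvgMl_tmp; exact: cvg_inv_sqr.
by under eq_fun do rewrite expr2; rewrite expr2; apply: cvgM; exact: cvg_psic.
Qed.

Lemma cvg_half_chord : half_chord lam @[lam --> +oo] --> r * c.
Proof.
rewrite -[X in _ --> X]ger0_norm ?mulr_ge0 ?(ltW r_gt0) ?(ltW c_gt0)//.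
rewrite -sqrtr_sqr; apply: continuous_cvg.
  exact: sqrt_continuous.
exact: cvg_radicand.
Qed.

Lemma near_half_chord : \forall lam \near +oo,
  [/\ 0 < lam, 0 < half_chord lam &
   half_chord lam ^+ 2 = (psi lam rho r * c) ^+ 2 - 2 * rho * r / lam ^+ 2].
Proof.
have rc0 : 0 < (r * c) ^+ 2 by rewrite exprn_gt0// mulr_gt0.
near=> lam.
have h : 0 < (psi lam rho r * c) ^+ 2 - 2 * rho * r / lam ^+ 2.
  by near: lam; exact: (cvgr_gt _ cvg_radicand _ rc0).
split; first by near: lam; apply: nbhs_pinfty_gt; exact: num_real.
  by rewrite sqrtr_gt0.
by rewrite sqr_sqrtr// ltW.
Unshelve. all: by end_near. Qed.

(** The conjugate form of the smaller root, in which the limit is apparent. *)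
Lemma near_entryE : \forall lam \near +oo, entry lam =
  2 * rho * r / (psi lam rho r * c + half_chord lam).
Proof.
near=> lam.
have [l0 h0 h2] : [/\ 0 < lam, 0 < half_chord lam &
   half_chord lam ^+ 2 = (psi lam rho r * c) ^+ 2 - 2 * rho * r / lam ^+ 2].
  by near: lam; exact: near_half_chord.
have p0 : 0 < psi lam rho r * c by rewrite mulr_gt0 ?psi_gt0.
have s0 : psi lam rho r * c + half_chord lam != 0 by rewrite gt_eqF ?addr_gt0.
apply: (mulIf s0); rewrite divfK// /entry -[LHS]mulrA -subr_sqr h2.
by rewrite opprB addrCA subrr addr0 mulrC divfK// gt_eqF ?exprn_gt0.
Unshelve. all: by end_near. Qed.

Lemma cvg_entry : entry lam @[lam --> +oo] --> rho / c.
Proof.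
have E : rho / c = 2 * rho * r / (r * c + r * c).
  by field; rewrite !gt_eqF ?addr_gt0 ?mulr_gt0.
rewrite E; apply: cvg_trans; first apply: near_eq_cvg.
  near=> lam; symmetry; near: lam; exact: near_entryE.
apply: cvgMl_tmp; apply: cvgV; first by rewrite gt_eqF ?addr_gt0 ?mulr_gt0.
by apply: cvgD; [exact: cvg_psic|exact: cvg_half_chord].
Unshelve. all: by end_near. Qed.

(** The second-order expansion of the entry abscissa, read off the quadratic
    equation it satisfies. *)
Lemma cvg_entry_defect :
  lam ^+ 2 * (entry lam - rho / c) @[lam --> +oo] -->
  ((rho / c) ^+ 2 - 2 * rho ^+ 2) / (2 * r * c).
Proof.
apply: (@cvg_trans _ (((entry lam) ^+ 2 - 2 * rho * (2 * rho * r /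
    (psi lam rho r + r))) / (2 * psi lam rho r * c) @[lam --> +oo])).
  apply: near_eq_cvg; near=> lam.
  have [l0 h0 h2] : [/\ 0 < lam, 0 < half_chord lam &
     half_chord lam ^+ 2 = (psi lam rho r * c) ^+ 2 - 2 * rho * r / lam ^+ 2].
    by near: lam; exact: near_half_chord.
  have p0 : 0 < psi lam rho r by rewrite psi_gt0.
  have psi2 := psi_sqr l0 rho_gt0 r_gt0.
  have quad : entry lam ^+ 2 =
      lam ^+ 2 * (2 * (psi lam rho r * c) * entry lam - 2 * rho * r).
    rewrite /entry; set h := half_chord lam in h2 *.
    set p := psi lam rho r * c in h2 *.
    have -> : 2 * rho * r = lam ^+ 2 * (p ^+ 2 - h ^+ 2).
      by rewrite h2 opprB addrCA subrr addr0 [RHS]mulrC divfK// gt_eqF ?exprn_gt0.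
    by ring.
  have off : 2 * rho * r / (psi lam rho r + r) = lam ^+ 2 * (psi lam rho r - r).
    have pr0 : psi lam rho r + r != 0 by rewrite gt_eqF ?addr_gt0.
    apply: (mulIf pr0); rewrite divfK// -[RHS]mulrA -subr_sqr psi2.
    by rewrite addrAC subrr add0r [RHS]mulrC divfK// gt_eqF ?exprn_gt0.
  rewrite quad off; field.
  by rewrite !gt_eqF.
have -> : ((rho / c) ^+ 2 - 2 * rho ^+ 2) / (2 * r * c) =
    ((rho / c) ^+ 2 - 2 * rho * (2 * rho * r / (r + r))) / (2 * r * c).
  by field; rewrite !gt_eqF ?addr_gt0.
apply: cvgM.
  apply: cvgB.
    by under eq_fun do rewrite expr2; rewrite expr2; apply: cvgM; exact: cvg_entry.
  apply: cvgMl_tmp; apply: cvgMl_tmp; apply: cvgV.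
    by rewrite gt_eqF ?addr_gt0.
  by apply: cvgD; [exact: cvg_psi|exact: cvg_cst].
apply: cvgV; first by rewrite gt_eqF ?mulr_gt0.
by apply: cvgMr_tmp; apply: cvgMl_tmp; exact: cvg_psi.
Unshelve. all: by end_near. Qed.

End fixed_mark.

(** Completing the square: along the ray the power is a quadratic polynomial
    of the abscissa, whose roots are the end points of a chord. *)
Lemma power_entry lam t z (s : R) : 0 < lam ->
  let p := psi lam (mark_rho z) (mark_radius z) * cos (mark_theta z - t) in
  let h := half_chord (mark_rho z) (mark_radius z) (cos (mark_theta z - t)) lam in
  h ^+ 2 = p ^+ 2 - 2 * mark_rho z * mark_radius z / lam ^+ 2 ->
  power lam z (polar s t) =
    lam ^+ 2 * ((p - s / lam ^+ 2) ^+ 2 - h ^+ 2).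
Proof.
move=> l0 p h h2; rewrite power_polar h2 /p.
by field; rewrite gt_eqF.
Qed.

Section configuration.
Variables (S : set mark) (t Rstar : R) (zh : mark).
Hypotheses (Rstar_gt0 : 0 < Rstar)
  (rho_gt0 : forall z, S z -> 0 < mark_rho z)
  (rad_gt : forall z, S z -> Rstar < mark_radius z)
  (finS : locally_finite S) (surS : surrounded S) (hit_zh : first_hit S t zh).

Let rad_gt0 z : S z -> 0 < mark_radius z.
Proof. by move=> /rad_gt; exact: lt_trans. Qed.

Let entryh lam :=
  entry (mark_rho zh) (mark_radius zh) (cos (mark_theta zh - t)) lam.

(** On a square of half-side [M], the linear part of the power of a surrounding
    mark is at most [- mark_radius z], and the quadratic part tends to [0]. *)
Lemma near_bounded_vacant :
  \forall lam \near +oo, bounded_set (vacant_cell lam S).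
Proof.
have [M0 sur] := surS; pose M := 2 * `|M0| + 1.
have M_gt0 : 0 < M by rewrite ltr_wpDl// mulr_ge0.
have small : \forall lam \near +oo, 2 * M ^+ 2 * lam ^- 2 < Rstar.
  have : 2 * M ^+ 2 * lam ^- 2 @[lam --> +oo] --> (2 * M ^+ 2 * 0 : R).
    by apply: cvgMl_tmp; exact: cvg_inv_sqr.
  by move=> /cvgr_lt; apply; rewrite mulr0.
near=> lam.
have l0 : 0 < lam by near: lam; apply: nbhs_pinfty_gt; exact: num_real.
apply: (@bounded_vacant _ _ _ l0 rho_gt0 rad_gt0 M) => // y yM.
have [z [Sz zM dz]] := sur y; exists z => //.
have r0 := rad_gt0 Sz; have rho0 := rho_gt0 Sz.
have pr := psi_ge l0 rho0 r0.
have [y1 y2] := norm_pair_le y.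
have sq : y.1 ^+ 2 + y.2 ^+ 2 <= 2 * M ^+ 2.
  by rewrite mulr2n mulrDl mul1r -yM -(real_normK (num_real y.1))
    -(real_normK (num_real y.2)) lerD// ler_pXn2r ?nnegrE.
have hM : 2 * M ^+ 2 * lam ^- 2 < Rstar by near: lam; exact: small.
have lt1 : (y.1 ^+ 2 + y.2 ^+ 2) / lam ^+ 2 < mark_radius z.
  apply: lt_trans (rad_gt Sz); apply: le_lt_trans hM.
  by rewrite ler_pM2r// invr_gt0 exprn_gt0.
have lt2 : mark_radius z * M <=
    2 * psi lam (mark_rho z) (mark_radius z) * dotu z y.
  have d0 : 0 <= 2 * dotu z y by rewrite (le_trans _ dz).
  rewrite -yM mulrAC [leRHS]mulrC.
  by rewrite (le_trans (ler_wpM2l (ltW r0) dz))// ler_wpM2r.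
have lt3 : 2 * mark_rho z * mark_radius z <= (M - 1) * mark_radius z.
  rewrite /M addrK ler_pM2r// ler_pM2l//.
  by rewrite (le_trans zM)// ler_norm.
by rewrite /power; nra.
Unshelve. all: by end_near. Qed.

Let L := reach t zh.

(** For large [lam], the disc of [zh] is the first one met by the ray: beyond a
    fixed distance no disc matters, and each of the finitely many remaining
    ones is close to a half-plane met strictly later. *)
Lemma near_defect (K0 : set (R * R)) : \forall lam \near +oo,
  defect K0 S lam t = entryh lam - L.
Proof.
have [Szh c0 hmin] := hit_zh.
have L0 : 0 < L by exact: reach_gt0 hit_zh.
have rhoh := rho_gt0 Szh; have radh := rad_gt0 Szh.
have entryL : entryh lam @[lam --> +oo] --> L by exact: cvg_entry.
pose K := L + 2; pose M := K + 2 * K ^+ 2 / Rstar.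
have K_gt0 : 0 < K by rewrite addr_gt0.
have near_other : \forall lam \near +oo, forall z, S z /\ mark_rho z <= M ->
    z <> zh -> psi lam (mark_rho z) (mark_radius z) * cos (mark_theta z - t)
      * entryh lam < mark_rho z * mark_radius z.
  apply: (@near_finite _ _ +oo _ _ (fun z lam => z <> zh ->
    psi lam (mark_rho z) (mark_radius z) * cos (mark_theta z - t)
      * entryh lam < mark_rho z * mark_radius z) (finS M)) => z [Sz _].
  have [->|/eqP nz] := eqVneq z zh; first by near=> lam; move=> /(_ erefl).
  have r0 := rad_gt0 Sz; have rho0 := rho_gt0 Sz.
  have lim : psi lam (mark_rho z) (mark_radius z) * cos (mark_theta z - t)
      * entryh lam @[lam --> +oo] --> mark_radius z * cos (mark_theta z - t) * L.
    by apply: cvgM => //; apply: cvgMr_tmp; exact: cvg_psi.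
  have ltl : mark_radius z * cos (mark_theta z - t) * L <
      mark_rho z * mark_radius z.
    rewrite -mulrA [ltRHS]mulrC ltr_pM2l// mulrC.
    by rewrite -dotu_polar (below_others rho_gt0 hit_zh)// lexx ltW.
  by near=> lam => _; near: lam; exact: (cvgr_lt _ lim _ ltl).
near=> lam.
have l1 : 1 <= lam by near: lam; exact: nbhs_pinfty_ge.
have [l0 h0 h2] : [/\ 0 < lam,
    0 < half_chord (mark_rho zh) (mark_radius zh) (cos (mark_theta zh - t)) lam &
    half_chord (mark_rho zh) (mark_radius zh) (cos (mark_theta zh - t)) lam ^+ 2 =
    (psi lam (mark_rho zh) (mark_radius zh) * cos (mark_theta zh - t)) ^+ 2
      - 2 * mark_rho zh * mark_radius zh / lam ^+ 2].
  by near: lam; exact: near_half_chord.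
have eL : entryh lam < L + 1.
  by near: lam; apply: (cvgr_lt _ entryL); rewrite ltrDl.
have e0 : 0 < entryh lam by near: lam; exact: (cvgr_gt _ entryL).
have others : forall z, S z /\ mark_rho z <= M ->
    z <> zh -> psi lam (mark_rho z) (mark_radius z) * cos (mark_theta z - t)
      * entryh lam < mark_rho z * mark_radius z by near: lam.
have l2 : 0 < lam ^+ 2 by rewrite exprn_gt0.
have pzh (s : R) := power_entry s l0 h2.
have far z y : S z -> M < mark_rho z -> y.1 ^+ 2 + y.2 ^+ 2 <= K ^+ 2 ->
    0 <= power lam z y.
  by move=> Sz; apply: power_far => //; exact: rad_gt.
have polK (s : R) : 0 <= s <= entryh lam ->
    (polar s t).1 ^+ 2 + (polar s t).2 ^+ 2 < K ^+ 2.
  move=> /andP[s0 se]; rewrite -enorm_sqr enorm_polar// ltr_pXn2r ?nnegrE ?(ltW K_gt0)//.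
  by rewrite (le_lt_trans se)// (lt_trans eL)// ltrD2l ltr1n.
have near_z (s : R) z : 0 <= s <= entryh lam -> S z -> mark_rho z <= M ->
    z <> zh -> 0 < power lam z (polar s t).
  move=> /andP[s0 se] Sz zM nz; rewrite power_polar.
  have r0 := rad_gt0 Sz; have rho0 := rho_gt0 Sz.
  have p0 := psi_gt0 l0 rho0 r0.
  have lt1 := others z (conj Sz zM) nz.
  set p := psi _ _ _ in p0 lt1 *; clearbody p.
  rewrite -addrA ltr_wpDl//.
    by rewrite divr_ge0 ?sqr_ge0 ?(ltW l2).
  rewrite addrC subr_gt0 -!mulrA ltr_pM2l//.
  have [c|c] := leP (cos (mark_theta z - t)) 0.
    have h1 : p * (cos (mark_theta z - t) * s) <= 0.
      by rewrite mulr_ge0_le0 ?(ltW p0) ?mulr_le0_ge0.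
    by apply: le_lt_trans h1 _; rewrite mulr_gt0.
  by apply: le_lt_trans lt1; rewrite mulrA ler_pM2l// mulr_gt0.
have le_chord (s : R) : s <= entryh lam ->
    half_chord (mark_rho zh) (mark_radius zh) (cos (mark_theta zh - t)) lam <=
    psi lam (mark_rho zh) (mark_radius zh) * cos (mark_theta zh - t) - s / lam ^+ 2.
  by move=> se; rewrite lerBrDl -lerBrDr ler_pdivrMr// mulrC.
have power_zh (s : R) : s <= entryh lam -> 0 <= power lam zh (polar s t).
  move=> se; rewrite pzh mulr_ge0 ?(ltW l2)// subr_ge0.
  have := le_chord s se => hc.
  by rewrite ler_pXn2r// nnegrE ?(le_trans _ hc)// ltW.
have power_zh_gt (s : R) : s < entryh lam -> 0 < power lam zh (polar s t).
  move=> se; rewrite pzh mulr_gt0// subr_gt0.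
  have hc : half_chord (mark_rho zh) (mark_radius zh) (cos (mark_theta zh - t)) lam <
    psi lam (mark_rho zh) (mark_radius zh) * cos (mark_theta zh - t) - s / lam ^+ 2.
    by rewrite ltrBrDl -ltrBrDr ltr_pdivrMr// mulrC.
  by rewrite ltr_pXn2r// nnegrE ?(ltW (lt_trans h0 hc))// ltW.
rewrite /defect (dist0_crofton rho_gt0 finS hit_zh); congr (_ - _).
apply: (@dist0_rescaled _ _ _ l0 rho_gt0 rad_gt0 _ _ _ (2 * lam ^+ 2 *
   half_chord (mark_rho zh) (mark_radius zh) (cos (mark_theta zh - t)) lam) zh) => //.
- by near: lam; exact: near_bounded_vacant.
- by rewrite !mulr_gt0.
- move=> s z se Sz; have [zM|Mz] := leP (mark_rho z) M; last first.
    by apply: far => //; rewrite ltW ?polK.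
  have [->|/eqP nz] := eqVneq z zh; last by rewrite ltW ?near_z.
  by case/andP: se => _; exact: power_zh.
- move=> s /andP[s0 se].
  have sse : 0 <= s <= entryh lam by rewrite s0 ltW.
  have n1 : \forall y \near polar s t, forall z, S z /\ mark_rho z <= M ->
      0 < power lam z y.
    apply: (@near_finite _ _ (nbhs (polar s t)) _ _
      (fun z y => 0 < power lam z y) (finS M)) => z [Sz zM].
    apply: (cvgr_gt _ (@continuous_power _ lam z (polar s t))).
    have [->|/eqP nz] := eqVneq z zh; last exact: near_z.
    exact: power_zh_gt.
  have n2 : \forall y \near polar s t, y.1 ^+ 2 + y.2 ^+ 2 < K ^+ 2.
    have cq : (fun y : R * R => y.1 ^+ 2 + y.2 ^+ 2) y @[y --> polar s t] -->
        (polar s t).1 ^+ 2 + (polar s t).2 ^+ 2.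
      by apply: cvgD; rewrite expr2; apply: cvgM; (exact: cvg_fst || exact: cvg_snd).
    exact: (cvgr_lt _ cq _ (polK s sse)).
  near=> y => z Sz; have [zM|Mz] := leP (mark_rho z) M.
    by apply: ltW; apply: (near n1 y).
  by apply: far => //; apply: ltW; near: y.
- move=> s /andP[es se]; rewrite pzh pmulr_rlt0// subr_lt0.
  set h := half_chord _ _ _ _ in h0 h2 se *; set p := psi _ _ _ * _ in h2 *.
  have e1 : p - s / lam ^+ 2 < h.
    by rewrite ltrBlDl -ltrBlDr ltr_pdivlMr// mulrC.
  have e2 : - h < p - s / lam ^+ 2.
    rewrite ltrBrDl -ltrBrDr opprK ltr_pdivrMr//.
    rewrite (lt_le_trans se)// /entryh /entry -/h -/p.
    by rewrite [leRHS]mulrC -mulrA mulrCA -mulrDr ler_pM2l//; lra.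
  by rewrite -(real_normK (num_real (_ - _))) ltr_pXn2r ?nnegrE ?(ltW h0)// ltr_norml e2.
Unshelve. all: by end_near. Qed.

Lemma cvg_defect (K0 : set (R * R)) :
  (fun lam : R => lam ^+ 2 * defect K0 S lam t) @ +oo --> Zlimit S t.
Proof.
have [Szh c0 hmin] := hit_zh.
rewrite /Zlimit /Lhit /Upsilon /Theta /Radius (hit_markE rho_gt0 finS hit_zh).
have rhoh := rho_gt0 Szh; have radh := rad_gt0 Szh.
set c := cos (mark_theta zh - t).
rewrite -/c in c0; have -> : cos (2 * (mark_theta zh - t)) = 2 * c ^+ 2 - 1.
  by rewrite mulrC -[_ * 2]/(_ * 2%:R) mulr_natr cos_mulr2n mulr2n mulr_natl mulr2n.
have -> : - ((mark_rho zh / c) ^+ 2 / 2) * ((2 * c ^+ 2 - 1) / (mark_radius zh * c)) =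
   ((mark_rho zh / c) ^+ 2 - 2 * mark_rho zh ^+ 2) / (2 * mark_radius zh * c).
  by field; rewrite !gt_eqF.
apply: cvg_trans (cvg_entry_defect rhoh radh c0).
apply: near_eq_cvg; near=> lam; congr (_ * _).
by symmetry; near: lam; exact: near_defect.
Unshelve. all: by end_near. Qed.

End configuration.
End asymptotics.

(** * The intensity measure *)

Section plane_measure.
Context (R : realType).
Local Open Scope ereal_scope.

(** The plane Lebesgue measure as a named constant, so as to equip it with its
    structure of sigma-finite measure. *)
Definition lebesgue2 : set (measurableTypeR R * measurableTypeR R) -> \bar R :=
  lebesgue_measure \x lebesgue_measure.

HB.instance Definition _ := Measure.on lebesgue2.

Let lebesgue2_sigma_finite : sigma_finite setT lebesgue2.
Proof.
have /sigma_finiteP[F [TF ndF Foo]] := sigma_finiteT (@lebesgue_measure R).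
exists (fun n => F n `*` F n).
  apply/seteqP; split=> [[x y] _|//].
  have [[n _ Fx] [m _ Fy]] : (\bigcup_n F n) x /\ (\bigcup_n F n) y.
    by rewrite -TF.
  exists (maxn n m) => //; split.
    exact: (subsetPset _ _ (ndF _ _ (leq_maxl n m))).
  exact: (subsetPset _ _ (ndF _ _ (leq_maxr n m))).
move=> k; have [mF Fk] := Foo k; split; first exact: measurableX.
by rewrite /lebesgue2 product_measure1E// lte_mul_pinfty// ge0_fin_numE.
Qed.

HB.instance Definition _ :=
  Measure_isSigmaFinite.Build _ _ _ lebesgue2 lebesgue2_sigma_finite.

End plane_measure.

Section intensity_integrals.
Context (R : realType) (mu : probability (measurableTypeR R) R).
Local Notation mark := (measurableTypeR R * measurableTypeR R *
                        measurableTypeR R)%type.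
Local Notation leb := (@lebesgue_measure R).

HB.instance Definition _ := Measure.on (intensity mu).

Lemma triple_integral (f : mark -> \bar R) :
  measurable_fun setT f -> (forall z, 0 <= f z)%E ->
  (\int[intensity mu]_z f z =
   \int[mu]_r \int[leb]_theta \int[leb]_rho f (rho, theta, r))%E.
Proof.
move=> mf f0; transitivity (\int[lebesgue2 (R:=R) \x mu]_z f z)%E => //.
rewrite fubini_tonelli2//; apply: eq_integral => r _; rewrite /fubini_G.
rewrite [LHS](_ : _ = \int[lebesgue_measure \x lebesgue_measure]_x f (x, r))%E//.
rewrite (@fubini_tonelli2 _ _ _ _ R lebesgue_measure lebesgue_measure)//.
exact: measurableT_comp.
Qed.

Lemma measurable_rho : measurable_fun setT (@mark_rho R).
Proof. exact: measurableT_comp. Qed.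

Lemma measurable_theta : measurable_fun setT (@mark_theta R).
Proof. exact: measurableT_comp. Qed.

Lemma measurable_radius : measurable_fun setT (@mark_radius R).
Proof. exact: measurable_snd. Qed.

Lemma measurable_pred d (T : measurableType d) (b : T -> bool) :
  measurable_fun setT b -> measurable [set x | b x].
Proof.
move=> mb; rewrite -[X in measurable X]setTI.
by have := mb measurableT [set true] I.
Qed.

Lemma measurable_cosB (t : R) :
  measurable_fun setT (fun a : measurableTypeR R => cos (a - t)).
Proof.
apply: continuous_measurable_fun => x.
apply: continuous_comp; last exact: continuous_cos.
by apply: cvgB; [exact: cvg_id|exact: cvg_cst].
Qed.

Lemma measurable_mark_space : measurable (@mark_space R).
Proof.
rewrite (_ : @mark_space R = [set z | 0 <= mark_rho z] `&`
  ([set z | 0 <= mark_theta z] `&` [set z | mark_theta z < 2 * pi]) `&`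
  [set z | 0 <= mark_radius z]).
  by repeat apply: measurableI; apply: measurable_pred;
    (apply: measurable_fun_ler || apply: measurable_fun_ltr);
    (exact: measurable_rho || exact: measurable_theta
     || exact: measurable_radius || exact: measurable_cst).
apply/seteqP; split=> z /=; first by move=> [-> /andP[-> ->] ->].
by move=> [[h [h1 h2]] h3]; split=> //; apply/andP.
Qed.

Variable t : R.

(** The marks with abscissa in [`]a, b]] and other coordinates in [G]. In this
    form the possible distances to the line, for a given angle and radius, make
    up an interval of length [b - a] times the cosine. *)
Definition cell (a b : R) (G : set (measurableTypeR R * measurableTypeR R)) :
    set mark :=
  [set z | [/\ mark_space z, 0 < cos (mark_theta z - t),
     a * cos (mark_theta z - t) < mark_rho z <= b * cos (mark_theta z - t) &
     G (mark_theta z, mark_radius z)]].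

Lemma cell_sub (a b : R) G : cell a b G `<=` @mark_space R.
Proof. by move=> z []. Qed.

Lemma measurable_cell (a b : R) G : measurable G -> measurable (cell a b G).
Proof.
move=> mG.
have mc : measurable_fun setT (fun z : mark => cos (mark_theta z - t)).
  exact: measurableT_comp (measurable_cosB t) measurable_theta.
have mr := measurable_rho.
rewrite (_ : cell a b G = @mark_space R `&`
  [set z : mark | 0 < cos (mark_theta z - t)] `&`
  [set z | a * cos (mark_theta z - t) < mark_rho z] `&`
  [set z | mark_rho z <= b * cos (mark_theta z - t)] `&`
  ((fun z : mark => (mark_theta z, mark_radius z)) @^-1` G)); last first.
  apply/seteqP; split=> z; first by move=> [? ? /andP[? ?] ?]; split=> //.
  by move=> [[[[? ?] h1] h2] ?]; split=> //; rewrite h1.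
apply: measurableI; last first.
  rewrite -[X in measurable X]setTI.
  have mtr : measurable_fun setT (fun z : mark => (mark_theta z, mark_radius z)).
    by apply: measurable_fun_pair; [exact: measurable_theta|exact: measurable_radius].
  exact: (mtr measurableT _ mG).
apply: measurableI; last first.
  apply: measurable_pred; apply: measurable_fun_ler => //.
  by apply: measurable_funM => //; exact: measurable_cst.
apply: measurableI; last first.
  apply: measurable_pred; apply: measurable_fun_ltr => //.
  by apply: measurable_funM => //; exact: measurable_cst.
apply: measurableI; first exact: measurable_mark_space.
by apply: measurable_pred; apply: measurable_fun_ltr => //; exact: measurable_cst.
Qed.

(** The rate at which the ray meets lines of polar angle [theta]. *)
Definition crossing_rate (theta : R) : R := Num.max 0 (cos (theta - t)).

Definition angle_radius_space : set (measurableTypeR R * measurableTypeR R) :=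
  [set p | 0 <= p.1 < 2 * pi /\ 0 <= p.2].

Definition rate (G : set (measurableTypeR R * measurableTypeR R))
    (p : measurableTypeR R * measurableTypeR R) : R :=
  crossing_rate p.1 * \1_(angle_radius_space `&` G) p.

Lemma crossing_rate_ge0 theta : 0 <= crossing_rate theta.
Proof. by rewrite /crossing_rate le_max lexx. Qed.

Lemma rate_ge0 G p : 0 <= rate G p.
Proof. by rewrite mulr_ge0 ?crossing_rate_ge0. Qed.

Lemma measurable_angle_radius_space : measurable angle_radius_space.
Proof.
rewrite (_ : angle_radius_space = `[0, 2 * pi[%classic `*` `[0, +oo[%classic).
  by apply: measurableX; exact: measurable_itv.
by apply/seteqP; split=> -[x y] /=; rewrite !in_itv/= andbT.
Qed.

Lemma measurable_crossing_rate :
  measurable_fun setT (crossing_rate : measurableTypeR R -> _).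
Proof.
by apply: measurable_maxr; [exact: measurable_cst|exact: measurable_cosB].
Qed.

Lemma measurable_rate G : measurable G -> measurable_fun setT (rate G).
Proof.
move=> mG; apply: measurable_funM.
  exact: measurableT_comp measurable_crossing_rate measurable_fst.
by apply: measurable_indic; apply: measurableI => //;
  exact: measurable_angle_radius_space.
Qed.

Lemma intensity_cell_integral (a b : R) G : 0 <= a <= b -> measurable G ->
  (intensity mu (cell a b G) =
   \int[mu]_r \int[leb]_theta ((b - a) * rate G (theta, r))%:E)%E.
Proof.
move=> /andP[a0 ab] mG; have mC := measurable_cell a b mG.
transitivity (\int[intensity mu]_z (\1_(cell a b G) z)%:E)%E.
  by rewrite integral_indic// setIT.
rewrite triple_integral; last 2 first.
- by apply/measurable_EFinP; exact: measurable_indic.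
- by move=> z; rewrite lee_fin.
apply: eq_integral => r _; apply: eq_integral => theta _.
have [[[ar Gr] c0]|nc] := pselect
    ((angle_radius_space `&` G) (theta, r) /\ 0 < cos (theta - t)).
  rewrite /rate /crossing_rate indicE mem_set// mulr1 max_r ?(ltW c0)//.
  set c := cos (theta - t) in c0 *.
  transitivity (\int[leb]_rho (\1_(`]a * c, b * c]%classic : set R) rho)%:E)%E.
    apply: eq_integral => rho _; rewrite !indicE; congr ((nat_of_bool _)%:R%:E).
    apply/idP/idP; rewrite !inE /= in_itv /=; first by case.
    move=> hrho; case: ar => /= h1 h2; split=> //; split=> //.
    rewrite /mark_rho/=; case/andP: hrho => h3 _.
    by rewrite (le_trans _ (ltW h3))// mulr_ge0// ltW.
  rewrite integral_indic// setIT.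
  transitivity (lebesgue_measure (`]a * c, b * c]%classic : set R)) => //.
  rewrite lebesgue_measure_itv/= lte_fin -EFinD -mulrBl.
  rewrite ltr_pM2r//; case: ltP => // ba.
  by rewrite (_ : b = a) ?subrr ?mul0r//; apply/eqP; rewrite eq_le ba.
rewrite (_ : rate G (theta, r) = 0).
  rewrite mulr0; apply: integral0_eq => rho _; rewrite indicE memNset//.
  move=> [[_ h1 h2] /= c0 _ Gr]; apply: nc; split=> //; split=> //.
rewrite /rate /crossing_rate indicE /=.
have [c0|c0] := leP (cos (theta - t)) 0; first by rewrite mul0r.
by rewrite memNset ?mulr0// => h; apply: nc.
Qed.

(** The intensity, per unit of abscissa along the ray, of the marks of [G]. *)
Definition weight (G : set (measurableTypeR R * measurableTypeR R)) : \bar R :=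
  intensity mu (cell 0 1 G).

Lemma intensity_cell (a b : R) G : 0 <= a <= b -> measurable G ->
  (intensity mu (cell a b G) = (b - a)%:E * weight G)%E.
Proof.
move=> ab mG; have mr := measurable_rate mG.
have mrE : measurable_fun setT (fun p => (rate G p)%:E) by apply/measurable_EFinP.
have ba : 0 <= b - a by rewrite subr_ge0; case/andP: ab.
have -> : weight G = (\int[mu]_r \int[leb]_theta (rate G (theta, r))%:E)%E.
  rewrite /weight intensity_cell_integral ?lexx ?ler01//.
  apply: eq_integral => r _; apply: eq_integral => theta _.
  by rewrite subr0 mul1r.
rewrite intensity_cell_integral// -ge0_integralZl ?lee_fin//; last 2 first.
- apply: (measurable_fun_fubini_tonelli_G (m1 := leb)
    (fun p => (rate G p)%:E)) => // p.
  by rewrite lee_fin rate_ge0.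
- by move=> r _; apply: integral_ge0 => th _; rewrite lee_fin rate_ge0.
apply: eq_integral => r _; rewrite -ge0_integralZl ?lee_fin//; last 2 first.
- exact: measurableT_comp mrE (pair2_measurable r).
- by move=> th _; rewrite lee_fin rate_ge0.
Qed.

Lemma weightC G : measurable G -> (weight G + weight (~` G) = weight setT)%E.
Proof.
move=> mG; rewrite /weight -measureU; last 3 first.
- exact: measurable_cell.
- by apply: measurable_cell; exact: measurableC.
- by apply/seteqP; split=> z //= -[[_ _ _ h1] [_ _ _ h2]].
congr (intensity mu _); apply/seteqP; split=> z.
  by move=> [[? ? ? ?]|[? ? ? ?]]; split.
by move=> [? ? ? _]; have [h|h] := pselect (G (mark_theta z, mark_radius z));
  [left|right]; split.
Qed.

End intensity_integrals.

(** * Polar angles modulo a full turn *)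

Section one_dimensional_integrals.
Context (R : realType).
Local Notation leb := (@lebesgue_measure R).
Local Open Scope ereal_scope.

Lemma lebesgue_measure_translation (c : R) (A : set R) : measurable A ->
  pushforward leb ((fun x => x + c)%R : measurableTypeR R -> measurableTypeR R) A
  = leb A.
Proof.
have mc : measurable_fun setT
    ((fun x => x + c)%R : measurableTypeR R -> measurableTypeR R).
  by apply: measurable_funD => //; exact: measurable_cst.
pose m : {measure set (measurableTypeR R) -> \bar R} := pushforward leb
  ((fun x => x + c)%R : measurableTypeR R -> measurableTypeR R).
move=> mA; apply/esym.
apply: (@lebesgue_measure_unique R (m mc)) => //= _ [[a b]] _ <-.
rewrite /m /pushforward /=.
rewrite (_ : _ @^-1` _ = `]a - c, b - c]%classic)%R; last first.
  by apply/seteqP; split=> x /=; rewrite !in_itv/= ltrBlDr lerBrDr.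
by rewrite !lebesgue_measure_itv/= !lte_fin ltrD2r -!EFinB opprB addrA subrK.
Qed.

Lemma ge0_integral_translation (c : R) (f : measurableTypeR R -> \bar R) :
  measurable_fun setT f -> (forall x, 0 <= f x) ->
  \int[leb]_x f (x + c)%R = \int[leb]_x f x.
Proof.
move=> mf f0.
have mc : measurable_fun setT
    ((fun x => x + c)%R : measurableTypeR R -> measurableTypeR R).
  by apply: measurable_funD => //; exact: measurable_cst.
pose m : {measure set (measurableTypeR R) -> \bar R} := pushforward leb
  ((fun x => x + c)%R : measurableTypeR R -> measurableTypeR R).
transitivity (\int[m mc]_x f x).
  by rewrite /m ge0_integral_pushforward.
by apply: eq_measure_integral => A mA _; exact: lebesgue_measure_translation.
Qed.

Lemma integral_derivative (f F : R -> R) (a b : R) : (a < b)%R ->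
  continuous f -> (forall x : R, is_derive x 1%R F (f x)) ->
  \int[leb]_(x in `[a, b]) (f x)%:E = (F b - F a)%R%:E.
Proof.
move=> ab cf dF; have cF : continuous F.
  by move=> x; apply/differentiable_continuous/derivable1_diffP; case: (dF x).
rewrite (continuous_FTC2 ab (F := F)) ?EFinB//.
- exact: continuous_subspaceT.
- split; first by move=> x _; case: (dF x).
    exact/cvg_at_right_filter/cF.
  exact/cvg_at_left_filter/cF.
- by move=> x _; rewrite derive1E; case: (dF x).
Qed.

Lemma integral_mul_indic (D : set (measurableTypeR R)) (f : R -> R) :
  \int[leb]_x (f x * \1_D x)%:E = \int[leb]_(x in D) (f x)%:E.
Proof.
rewrite [RHS]integral_mkcond; apply: eq_integral => x _.
by rewrite patchE indicE; case: ifP => _; rewrite ?mulr1 ?mulr0.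
Qed.

End one_dimensional_integrals.

Section angles.
Context (R : realType) (t : R).
Hypothesis t_range : 0 <= t < 2 * pi.
Local Notation leb := (@lebesgue_measure R).

(** A piecewise affine form of [angle_around t] valid on one full turn. *)
Definition angle_rep (theta : R) : R :=
  if t + pi < theta then theta - 2 * pi
  else if theta <= t - pi then theta + 2 * pi else theta.

Lemma angle_aroundE theta : 0 <= theta < 2 * pi ->
  angle_around t theta = angle_rep theta.
Proof.
move=> /andP[th1 th2]; have p0 := pi_gt0 R; have /andP[t1 t2] := t_range.
have p20 : 0 < 2 * pi :> R by rewrite mulr_gt0.
have ceilE (k : int) (x : R) : k%:~R = x ->
    (x - 1) * (2 * pi) < theta - t - pi -> theta - t - pi <= x * (2 * pi) ->
    (Num.ceil ((theta - t - pi) / (2 * pi)))%:~R = x.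
  move=> <- h1 h2; congr (_%:~R); apply: ceil_def.
  by rewrite intrB ltr_pdivlMr// ler_pdivrMr// h1.
rewrite /angle_around /angle_rep.
case: ltP => h1; first by rewrite (ceilE 1 1) ?mulr1//; lra.
case: leP => h2; last by rewrite (ceilE 0 0) ?mulr0 ?subr0//; lra.
by rewrite (ceilE (-1) (-1)) ?mulrN1 ?opprK//; lra.
Qed.

Lemma cos_angle_rep theta : cos (angle_rep theta - t) = cos (theta - t).
Proof.
have p : pi *+ 2 = 2 * pi :> R by rewrite mulr2n mulrDl mul1r.
rewrite /angle_rep; case: ifP => _.
  by rewrite -(cosD2pi (theta - 2 * pi - t)) p; congr cos; ring.
by case: ifP => _//; rewrite -(cosD2pi (theta - t)) p; congr cos; ring.
Qed.

Lemma measurable_angle_rep :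
  measurable_fun setT (angle_rep : measurableTypeR R -> measurableTypeR R).
Proof.
apply: measurable_fun_ifT; first by apply: measurable_fun_ltr => //; exact: measurable_cst.
  by apply: measurable_funB => //; exact: measurable_cst.
apply: measurable_fun_ifT; first by apply: measurable_fun_ler => //; exact: measurable_cst.
  by apply: measurable_funD => //; exact: measurable_cst.
exact: measurable_id.
Qed.

Lemma indic_oc (a b x : R) :
  \1_(`]a, b]%classic : set R) x = (a < x <= b)%R%:R :> R.
Proof. by rewrite indicE mem_setE in_itv. Qed.

Lemma indic_co (a b x : R) :
  \1_(`[a, b[%classic : set R) x = (a <= x < b)%R%:R :> R.
Proof. by rewrite indicE mem_setE in_itv. Qed.

Lemma indic_oo (a b x : R) :
  \1_(`]a, b[%classic : set R) x = (a < x < b)%R%:R :> R.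
Proof. by rewrite indicE mem_setE in_itv. Qed.

(** Changing the representative of the angle preserves integrals over a full
    turn: cut the turn into the pieces on which the representative is a fixed
    translate. *)
Lemma integral_angle_rep (h : measurableTypeR R -> R) : measurable_fun setT h ->
  (forall x, 0 <= h x) ->
  (\int[leb]_x (h (angle_rep x) * \1_(`[0, 2 * pi[%classic : set R) x)%:E =
   \int[leb]_x (h x * \1_(`]t - pi, t + pi]%classic : set R) x)%:E)%E.
Proof.
move=> mh h0; have p0 := pi_gt0 R; have /andP[t1 t2] := t_range.
pose H (c x : R) : R := h x * (\1_(`]t - pi, t + pi]%classic : set R) x *
  \1_(`[0, 2 * pi[%classic : set R) (x - c)).
have H0 c x : 0 <= H c x by rewrite !mulr_ge0// ?indic_oc ?indic_co ler0n.
have mH c : measurable_fun setT (H c : measurableTypeR R -> _).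
  apply: measurable_funM => //; apply: measurable_funM.
    by apply: measurable_indic; exact: measurable_itv.
  have mJ : measurable_fun setT
      (\1_(`[0, 2 * pi[%classic : set R) : measurableTypeR R -> R).
    by apply: measurable_indic; exact: measurable_itv.
  have mB : measurable_fun setT
      (fun x : measurableTypeR R => x - c : measurableTypeR R).
    by apply: measurable_funB => //; exact: measurable_cst.
  exact: (measurableT_comp mJ mB).
have mHE c : measurable_fun setT (fun x : measurableTypeR R => (H c x)%:E).
  by apply/measurable_EFinP.
have mHc c c' : measurable_fun setT (fun x : measurableTypeR R => (H c (x + c'))%:E).
  apply/measurable_EFinP.
  apply: (@measurableT_comp _ _ _ _ _ _ (H c : measurableTypeR R -> _)) => //.
  by apply: measurable_funD => //; exact: measurable_cst.
transitivity (\int[leb]_x ((H 0 (x + 0))%:E + ((H (2 * pi) (x + 2 * pi))%:E +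
    (H (- (2 * pi)) (x + - (2 * pi)))%:E)))%E.
  apply: eq_integral => x _; rewrite -!EFinD; congr EFin.
  rewrite /H /angle_rep !addrK !addr0 ?subr0 !indic_oc !indic_co.
  have [Jx|Jx] := boolP (0 <= x < 2 * pi); last by rewrite !mulr0 !addr0.
  case/andP: Jx => J1 J2.
  have [x1|x1] := boolP (t + pi < x).
    rewrite (_ : t - pi < x <= t + pi = false); last by apply/negP => /andP[]; lra.
    rewrite (_ : t - pi < x + 2 * pi <= t + pi = false); last first.
      by apply/negP => /andP[]; lra.
    rewrite (_ : t - pi < x - 2 * pi <= t + pi = true); last by apply/andP; split; lra.
    by rewrite !mul0r !mulr0 !add0r !mulr1.
  have {}x1 : x <= t + pi by rewrite leNgt.
  have [x2|x2] := boolP (x <= t - pi).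
    rewrite (_ : t - pi < x <= t + pi = false); last by apply/negP => /andP[]; lra.
    rewrite (_ : t - pi < x + 2 * pi <= t + pi = true); last by apply/andP; split; lra.
    rewrite (_ : t - pi < x - 2 * pi <= t + pi = false); last first.
      by apply/negP => /andP[]; lra.
    by rewrite !mul0r !mulr0 !add0r !addr0 !mulr1.
  have {}x2 : t - pi < x by rewrite ltNge.
  rewrite (_ : t - pi < x <= t + pi = true); last by apply/andP; split; lra.
  rewrite (_ : t - pi < x + 2 * pi <= t + pi = false); last first.
    by apply/negP => /andP[]; lra.
  rewrite (_ : t - pi < x - 2 * pi <= t + pi = false); last first.
    by apply/negP => /andP[]; lra.
  by rewrite !mul0r !mulr0 !addr0 !mulr1.
rewrite !ge0_integralD//; last 5 first.
- by move=> x _; rewrite lee_fin.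
- by move=> x _; rewrite lee_fin.
- by move=> x _; rewrite lee_fin.
- by move=> x _; rewrite -EFinD lee_fin addr_ge0.
- exact: emeasurable_funD.
rewrite (ge0_integral_translation 0 (f := fun x => (H 0 x)%:E))//; last first.
  by move=> x; rewrite lee_fin.
rewrite (ge0_integral_translation (2 * pi) (f := fun x => (H (2 * pi) x)%:E))//; last first.
  by move=> x; rewrite lee_fin.
rewrite (ge0_integral_translation (- (2 * pi))
  (f := fun x => (H (- (2 * pi)) x)%:E))//; last by move=> x; rewrite lee_fin.
rewrite -!ge0_integralD//; last 5 first.
- by move=> x _; rewrite lee_fin.
- by move=> x _; rewrite -EFinD lee_fin addr_ge0.
- exact: emeasurable_funD.
- by move=> x _; rewrite lee_fin.
- by move=> x _; rewrite lee_fin.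
apply: eq_integral => x _; rewrite -!EFinD; congr EFin.
rewrite /H subr0 !indic_oc !indic_co -!mulrDr; congr (_ * _).
have [Ix|Ix] := boolP (t - pi < x <= t + pi); last by rewrite !mul0r.
rewrite !mul1r; case/andP: Ix => I1 I2.
have [x1|x1] := ltP x 0.
  rewrite (_ : 0 <= x - - (2 * pi) < 2 * pi = true); last by apply/andP; split; lra.
  rewrite (_ : 0 <= x - 2 * pi < 2 * pi = false); last by apply/negP => /andP[]; lra.
  by rewrite /= !add0r.
have [x2|x2] := ltP x (2 * pi).
  rewrite (_ : 0 <= x - - (2 * pi) < 2 * pi = false); last first.
    by apply/negP => /andP[]; lra.
  rewrite (_ : 0 <= x - 2 * pi < 2 * pi = false); last by apply/negP => /andP[]; lra.
  by rewrite /= !addr0.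
rewrite (_ : 0 <= x - - (2 * pi) < 2 * pi = false); last first.
  by apply/negP => /andP[]; lra.
rewrite (_ : 0 <= x - 2 * pi < 2 * pi = true); last by apply/andP; split; lra.
by rewrite /= addr0 add0r.
Qed.

(** The density of the angle in the limit law. *)
Definition cos_density (a : R) : R :=
  cos (a - t) * \1_(`]t - pi / 2, t + pi / 2[%classic : set R) a.

Lemma cos_density_ge0 a : 0 <= cos_density a.
Proof.
rewrite /cos_density indic_oo.
have [h|_] := boolP (t - pi / 2 < a < t + pi / 2); last by rewrite mulr0.
by rewrite mulr1 ltW// cos_gt0_pihalf//; lra.
Qed.

Lemma measurable_cos_density :
  measurable_fun setT (cos_density : measurableTypeR R -> _).
Proof.
apply: measurable_funM; first exact: measurable_cosB.
by apply: measurable_indic; exact: measurable_itv.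
Qed.

Lemma crossing_rate_angle_rep theta : 0 <= theta < 2 * pi ->
  crossing_rate t theta = cos_density (angle_rep theta).
Proof.
move=> /andP[th1 th2]; have p0 := pi_gt0 R; have /andP[t1 t2] := t_range.
rewrite /crossing_rate -cos_angle_rep /cos_density indic_oo.
have : t - pi < angle_rep theta <= t + pi.
  by rewrite /angle_rep; apply/andP; case: (ltP (t + pi) theta) => ?;
    [|case: (leP theta (t - pi)) => ?]; split; lra.
move: (angle_rep theta) => a /andP[a1 a2].
have [h|h] := boolP (t - pi / 2 < a < t + pi / 2).
  by rewrite mulr1 max_r// ltW// cos_gt0_pihalf//; lra.
rewrite mulr0 max_l//.
have [a3|a3] := leP a (t - pi / 2).
  rewrite -[cos _]opprK -cosDpi oppr_le0; apply: cos_ge0_pihalf.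
  by apply/andP; split; lra.
have a4 : t + pi / 2 <= a by move: h; rewrite a3/= -leNgt.
rewrite -(subrK pi (a - t)) cosDpi oppr_le0; apply: cos_ge0_pihalf.
by apply/andP; split; lra.
Qed.

Lemma integral_cos_density : (\int[leb]_a (cos_density a)%:E = 2%:E)%E.
Proof.
have p0 := pi_gt0 R.
rewrite integral_mul_indic.
have mc (D : set (measurableTypeR R)) :
    measurable_fun D (fun a : measurableTypeR R => (cos (a - t))%:E).
  by apply/measurable_EFinP/measurable_funTS; exact: measurable_cosB.
rewrite integral_itv_bndo_bndc; last exact: mc.
rewrite (@integral_itv_obnd_cbnd R (t - pi / 2) (BRight (t + pi / 2))
  (fun a => (cos (a - t))%:E)); last exact: mc.
have dS (x : R) : is_derive x (1 : R) (fun a => sin (a - t)) (cos (x - t)).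
  rewrite -[cos (x - t)]mulr1.
  have dB : is_derive x (1 : R) (fun a : R => a - t) 1.
    by have := is_deriveB (is_derive_id x (1 : R)) (is_derive_cst t x 1); rewrite subr0.
  have h := @is_derive1_comp R sin (fun a => a - t) x (cos (x - t)) 1
    (is_derive_sin (x - t)) dB.
  exact: h.
rewrite (integral_derivative _ _ dS).
- by congr EFin; rewrite [t + _]addrC [t - _]addrC !addrK sinN sin_pihalf; lra.
- by lra.
- move=> x; apply: continuous_comp; last exact: continuous_cos.
  by apply: cvgB; [exact: cvg_id|exact: cvg_cst].
Qed.

End angles.

(** * The limit law *)

Section limit_law.
Context (R : realType) (mu : probability (measurableTypeR R) R) (t : R).
Hypotheses (mu_nonneg : mu [set r : R | 0 <= r] = 1%E)
  (t_range : 0 <= t < 2 * pi).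
Local Notation mark := (measurableTypeR R * measurableTypeR R *
                        measurableTypeR R)%type.
Local Notation leb := (@lebesgue_measure R).
Implicit Types G : set (measurableTypeR R * measurableTypeR R).

(** The limit law uses the representative of the angle around [t], the process
    the one in [`[0, 2 * pi[]: this translates regions of the former kind. *)
Definition angle_pull G : set (measurableTypeR R * measurableTypeR R) :=
  [set p | G (angle_rep t p.1, p.2)].

Lemma measurable_angle_pull G : measurable G -> measurable (angle_pull G).
Proof.
move=> mG; rewrite -[X in measurable X]setTI.
have m : measurable_fun setT
    (fun p : measurableTypeR R * measurableTypeR R => (angle_rep t p.1, p.2)).
  apply: measurable_fun_pair; last exact: measurable_snd.
  exact: measurableT_comp (measurable_angle_rep t) measurable_fst.
exact: (m measurableT _ mG).
Qed.

Lemma integral_nonneg_radius (f : measurableTypeR R -> \bar R) :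
  measurable_fun setT f -> (forall r, 0 <= f r)%E ->
  (\int[mu]_r f r = \int[mu]_(r in [set r | 0 <= r]%R) f r)%E.
Proof.
move=> mf f0.
have mN : measurable ([set r | 0 <= r] : set (measurableTypeR R)).
  by rewrite (_ : [set r | 0 <= r] = `[0, +oo[%classic)//;
    apply/seteqP; split=> x /=; rewrite in_itv/= andbT.
rewrite (@ge0_negligible_integral _ _ _ mu setT (~` [set r | 0 <= r]))//.
- by rewrite setTD setCK.
- exact: measurableC.
- by have := probability_setC mu mN; rewrite mu_nonneg subee.
Qed.

Let angle_density G (p : measurableTypeR R * measurableTypeR R) : R :=
  cos_density t p.1 * \1_G p.

Let angle_density_ge0 G p : 0 <= angle_density G p.
Proof. by rewrite mulr_ge0 ?cos_density_ge0. Qed.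

Let measurable_angle_density G : measurable G ->
  measurable_fun setT (angle_density G).
Proof.
move=> mG; apply: measurable_funM; last exact: measurable_indic.
exact: measurableT_comp (measurable_cos_density t) measurable_fst.
Qed.

Lemma measurable_section_integral
    (f : measurableTypeR R * measurableTypeR R -> R) :
  measurable_fun setT f -> (forall p, 0 <= f p) ->
  measurable_fun setT (fun r => \int[leb]_a (f (a, r))%:E)%E.
Proof.
move=> mf f0.
apply: (measurable_fun_fubini_tonelli_G (m1 := leb) (fun p => (f p)%:E)).
  exact/measurable_EFinP.
by move=> p; rewrite lee_fin.
Qed.

(** Integrating out the distance leaves the crossing rate, which is the density
    of the limit law at the representative of the angle. *)
Lemma weight_angle_pull G : measurable G -> weight mu t (angle_pull G) =
  (\int[mu]_r \int[leb]_a (cos_density t a * \1_G (a, r))%:E)%E.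
Proof.
move=> mG; have p0 := pi_gt0 R.
have mG' := measurable_angle_pull mG.
rewrite /weight intensity_cell_integral ?lexx ?ler01//.
transitivity (\int[mu]_r \int[leb]_theta
    (rate t (angle_pull G) (theta, r))%:E)%E.
  by apply: eq_integral => r _; apply: eq_integral => th _; rewrite subr0 mul1r.
rewrite integral_nonneg_radius; last 2 first.
- exact: measurable_section_integral (measurable_rate t mG') (rate_ge0 t _).
- by move=> r; apply: integral_ge0 => th _; rewrite lee_fin rate_ge0.
rewrite [RHS]integral_nonneg_radius; last 2 first.
- exact: measurable_section_integral (measurable_angle_density mG)
    (angle_density_ge0 G).
- by move=> r; apply: integral_ge0 => th _; rewrite lee_fin mulr_ge0 ?cos_density_ge0.
apply: eq_integral => r; rewrite inE/= => r0.
pose h (a : measurableTypeR R) := angle_density G (a, r).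
have mh : measurable_fun setT h.
  exact: measurableT_comp (measurable_angle_density mG) (pair2_measurable r).
transitivity (\int[leb]_x (h (angle_rep t x) *
    \1_(`[0, 2 * pi[%classic : set R) x)%:E)%E.
  apply: eq_integral => x _; congr EFin; rewrite /rate /h /angle_density indic_co.
  have [hx|hx] := boolP (0 <= x < 2 * pi); last first.
    rewrite mulr0 indicE memNset ?mulr0// => -[[/= hx' _] _].
    by rewrite hx' in hx.
  rewrite mulr1 /= crossing_rate_angle_rep//; congr (_ * _).
  rewrite !indicE; congr ((nat_of_bool _)%:R); apply/idP/idP; rewrite !inE.
    by case.
  by move=> Gx; split=> //; split.
rewrite integral_angle_rep//; last by move=> x; exact: angle_density_ge0.
apply: eq_integral => x _; congr EFin; rewrite indic_oc.
have [hx|hx] := boolP (t - pi < x <= t + pi); first by rewrite mulr1.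
rewrite mulr0 /h /angle_density /cos_density indic_oo/=.
have [hx'|_] := boolP (t - pi / 2 < x < t + pi / 2); last by rewrite mulr0 mul0r.
by exfalso; move: hx => /negP; apply; case/andP: hx' => ? ?; apply/andP; split; lra.
Qed.

Lemma weightT : weight mu t setT = 2%:E.
Proof.
have -> : setT = angle_pull setT by apply/seteqP; split.
rewrite weight_angle_pull//.
transitivity (\int[mu]_r (cst 2%:E r))%E; last first.
  by have mT := probability_setT mu; rewrite integral_cst//= mT mule1.
apply: eq_integral => r _; rewrite /= -(integral_cos_density t).
by apply: eq_integral => a _; rewrite indicT mulr1.
Qed.

Lemma weight_fin G : measurable G -> weight mu t G \is a fin_num.
Proof.
move=> mG; rewrite ge0_fin_numE; last exact: measure_ge0.
apply: (@le_lt_trans _ _ (weight mu t setT)); last by rewrite weightT ltry.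
by rewrite -(weightC mu t mG) leeDl// measure_ge0.
Qed.

(** These sets form a pi-system on which both the limit law and the law of the
    first line are explicit. *)
Definition gen (s : R) G : set mark := [set x | x.1.1 <= s /\ G (x.1.2, x.2)].

Lemma measurable_gen s G : measurable G -> measurable (gen s G).
Proof.
move=> mG.
rewrite (_ : gen s G = [set x : mark | mark_rho x <= s] `&`
    ((fun x : mark => (mark_theta x, mark_radius x)) @^-1` G)); last first.
  by apply/seteqP; split=> x [].
apply: measurableI.
  apply: measurable_pred; apply: measurable_fun_ler; first exact: measurable_rho.
  exact: measurable_cst.
rewrite -[X in measurable X]setTI.
have m : measurable_fun setT (fun z : mark => (mark_theta z, mark_radius z)).
  by apply: measurable_fun_pair; [exact: measurable_theta|exact: measurable_radius].
exact: (m measurableT _ mG).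
Qed.

Definition gens : set (set mark) :=
  [set A | exists s G, measurable G /\ A = gen s G].

Lemma gens_generate : @measurable _ mark = <<s gens>>.
Proof.
apply/seteqP; split=> [A mA|]; last first.
  apply: smallest_sub; first exact: sigma_algebra_measurable.
  by move=> _ [s [G [mG ->]]]; exact: measurable_gen.
have mid : measurable_fun setT (idfun : g_sigma_algebraType gens -> mark).
  have gen_mem s G : measurable G -> measurable (gen s G : set (g_sigma_algebraType gens)).
    by move=> mG; apply: sub_sigma_algebra; exists s, G.
  have m1 : measurable_fun setT
      (fun x : g_sigma_algebraType gens => (x : mark).1.1 : measurableTypeR R).
    apply: (measurability _ (RGenOInfty.measurableE R)) => //.
    move=> _ [_ [s ->] <-].
    rewrite (_ : _ `&` _ = ~` (gen s setT : set (g_sigma_algebraType gens))).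
      by apply: measurableC; exact: gen_mem.
    apply/seteqP; split=> x /=; rewrite in_itv/= andbT.
      by move=> [_ sx] [xs _]; move: (lt_le_trans sx xs); rewrite ltxx.
    move=> h; split=> //; rewrite ltNge; apply/negP => xs; exact: h.
  have m2 : measurable_fun setT (fun x : g_sigma_algebraType gens =>
      ((x : mark).1.2, (x : mark).2) : measurableTypeR R * measurableTypeR R).
    move=> _ G mG; rewrite setTI.
    rewrite (_ : _ @^-1` _ = \bigcup_n (gen n%:R G : set (g_sigma_algebraType gens))).
      by apply: bigcup_measurable => n _; exact: gen_mem.
    apply/seteqP; split=> x /=; last by case=> n _ [].
    move=> Gx; exists (Num.bound `|(x : mark).1.1|) => //; split=> //.
    by apply: le_trans (ler_norm _) _; apply: ltW; exact: archi_boundP.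
  rewrite (_ : idfun = (fun x : g_sigma_algebraType gens =>
    (((x : mark).1.1, (x : mark).1.2), (x : mark).2) : mark)); last first.
    by apply/funext => -[[]].
  apply: measurable_fun_pair; last exact: measurableT_comp measurable_snd m2.
  apply: measurable_fun_pair => //.
  exact: measurableT_comp measurable_fst m2.
by have := mid measurableT _ mA; rewrite setTI.
Qed.

Let hit_density (x : mark) : R :=
  expR (- 2 * x.1.1) * cos (x.1.2 - t)
  * \1_(`]t - pi / 2, t + pi / 2[%classic : set R) x.1.2
  * \1_(`]0, +oo[%classic : set R) x.1.1.

Let hit_densityE x : hit_density x =
  (expR (- 2 * x.1.1) * \1_(`]0, +oo[%classic : set R) x.1.1)
  * cos_density t x.1.2.
Proof. by rewrite /hit_density /cos_density -!mulrA; congr (_ * _); ring. Qed.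

Let hit_density_ge0 x : 0 <= hit_density x.
Proof. by rewrite hit_densityE mulr_ge0 ?cos_density_ge0// mulr_ge0 ?expR_ge0. Qed.

Let measurable_exp_density : measurable_fun setT
  (fun l : measurableTypeR R => expR (- 2 * l) * \1_(`]0, +oo[%classic : set R) l).
Proof.
apply: measurable_funM; last by apply: measurable_indic; exact: measurable_itv.
apply: measurableT_comp; first exact: measurable_expR.
by apply: measurable_funM => //; exact: measurable_cst.
Qed.

Let measurable_hit_density : measurable_fun setT hit_density.
Proof.
rewrite (_ : hit_density = fun x => (expR (- 2 * x.1.1) *
   \1_(`]0, +oo[%classic : set R) x.1.1) * cos_density t x.1.2); last first.
  by apply/funext => x; rewrite hit_densityE.
apply: measurable_funM.
  exact: measurableT_comp measurable_exp_density (@measurable_rho R).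
exact: measurableT_comp (measurable_cos_density t) (@measurable_theta R).
Qed.

Let hit_law0 : hit_law mu t set0 = 0%E.
Proof. exact: integral_set0. Qed.

Let hit_law_ge0 B : (0 <= hit_law mu t B)%E.
Proof. by apply: integral_ge0 => x _; rewrite lee_fin hit_density_ge0. Qed.

Let hit_law_sigma_additive : semi_sigma_additive (hit_law mu t).
Proof.
move=> F mF tF mUF.
rewrite /hit_law ge0_integral_bigcup//.
- by apply: is_cvg_ereal_nneg_natsum => n _; apply: integral_ge0 => x _;
    rewrite lee_fin hit_density_ge0.
- by apply/measurable_EFinP; apply: measurable_funTS.
- by move=> x _; rewrite lee_fin hit_density_ge0.
Qed.

Definition hit_measure : set mark -> \bar R := hit_law mu t.

HB.instance Definition _ := isMeasure.Build _ _ _ hit_measure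
  hit_law0 hit_law_ge0 hit_law_sigma_additive.

Lemma integral_exp_density (s : R) : 0 < s ->
  (\int[leb]_l (expR (- 2 * l) * \1_(`]0%R, s]%classic : set R) l)%:E =
   ((1 - expR (- 2 * s)) / 2)%:E)%E.
Proof.
move=> s0; rewrite integral_mul_indic.
have me : measurable_fun `]0, s] (fun l : measurableTypeR R => (expR (- 2 * l))%:E).
  apply/measurable_EFinP; apply: measurable_funTS.
  apply: measurableT_comp; first exact: measurable_expR.
  by apply: measurable_funM => //; exact: measurable_cst.
rewrite (@integral_itv_obnd_cbnd R 0 (BRight s) (fun l => (expR (- 2 * l))%:E))//.
have dF (x : R) : is_derive x (1 : R) (fun l => - (expR (- 2 * l) / 2))
    (expR (- 2 * x)).
  have dm : is_derive x (1 : R) (fun l : R => - 2 * l) (- 2).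
    have := is_deriveZ (- 2) (is_derive_id x (1 : R)).
    by rewrite /GRing.scale /= mulr1.
  have de := @is_derive1_comp R expR (fun l => - 2 * l) x (expR (- 2 * x)) (- 2)
    (is_derive_expR _) dm.
  have E : (fun l : R => - (expR (- 2 * l) / 2)) =
      - 2^-1 *: (expR \o (fun l => - 2 * l)).
    apply/funext => l; rewrite -[RHS]/(- 2^-1 * expR (- 2 * l)) mulNr.
    by field.
  rewrite E; have := is_deriveZ (- 2^-1) de.
  by rewrite (_ : - 2^-1 *: _ = expR (- 2 * x))// /GRing.scale/=; field.
rewrite (integral_derivative s0 _ dF).
  by congr EFin; rewrite mulr0 expR0; field.
move=> x; apply: continuous_comp; last exact: continuous_expR.
by apply: cvgMl_tmp; exact: cvg_id.
Qed.

Lemma hit_law_gen s G : 0 < s -> measurable G ->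
  hit_law mu t (gen s G) =
  (((1 - expR (- 2 * s)) / 2)%:E * weight mu t (angle_pull G))%E.
Proof.
move=> s0 mG; have mgen := measurable_gen s mG.
have e0 : 0 <= (1 - expR (- 2 * s)) / 2.
  by rewrite divr_ge0// subr_ge0 -[leRHS]expR0 ler_expR; lra.
transitivity (\int[intensity mu]_x (hit_density x * \1_(gen s G) x)%:E)%E.
  transitivity (\int[intensity mu]_(x in gen s G) (hit_density x)%:E)%E => //.
  rewrite integral_mkcond; apply: eq_integral => x _.
  by rewrite patchE indicE; case: ifP => _; rewrite ?mulr1 ?mulr0.
rewrite triple_integral; last 2 first.
- by apply/measurable_EFinP; apply: measurable_funM => //; exact: measurable_indic.
- by move=> x; rewrite lee_fin mulr_ge0.
rewrite weight_angle_pull// -ge0_integralZl ?lee_fin//; last 2 first.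
- exact: measurable_section_integral (measurable_angle_density mG)
    (angle_density_ge0 G).
- by move=> r _; apply: integral_ge0 => th _; rewrite lee_fin mulr_ge0 ?cos_density_ge0.
apply: eq_integral => r _; rewrite -ge0_integralZl ?lee_fin//; last 2 first.
- apply/measurable_EFinP.
  exact: measurableT_comp (measurable_angle_density mG) (pair2_measurable r).
- by move=> th _; rewrite lee_fin mulr_ge0 ?cos_density_ge0.
apply: eq_integral => a _.
rewrite -(integral_exp_density s0) -ge0_integralZr ?lee_fin ?angle_density_ge0//.
- apply: eq_integral => l _; rewrite -EFinM; congr EFin.
  have key : \1_(`]0, +oo[%classic : set R) l * \1_(gen s G) (l, a, r) =
      \1_(`]0, s]%classic : set R) l * \1_G (a, r) :> R.
    rewrite !indicE -!natrM !mulnb; congr ((nat_of_bool _)%:R).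
    apply/andP/andP; rewrite !inE /= !in_itv/= ?andbT.
      by move=> [l0 [ls Gar]]; rewrite l0.
    by move=> [/andP[l0 ls] Gar].
  rewrite hit_densityE /=.
  transitivity (expR (- 2 * l) * cos_density t a *
    (\1_(`]0, +oo[%classic : set R) l * \1_(gen s G) (l, a, r))); first by ring.
  by rewrite key; ring.
- apply/measurable_EFinP; apply: measurable_funM.
    apply: measurableT_comp; first exact: measurable_expR.
    by apply: measurable_funM => //; exact: measurable_cst.
  by apply: measurable_indic; exact: measurable_itv.
- by rewrite mulr_ge0 ?cos_density_ge0.
Qed.

Lemma hit_law_le0 s G : s <= 0 -> hit_law mu t (gen s G) = 0%E.
Proof.
move=> s0; apply: integral0_eq => x [xs _]; congr EFin.
rewrite [X in _ * X]indicE memNset ?mulr0//= in_itv/= andbT => x0.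
by move: (lt_le_trans x0 xs); rewrite ltNge s0.
Qed.

(** Dynkin's uniqueness theorem for the pi-system of the sets [gen s G]. *)
Lemma hit_law_unique (m : {measure set mark -> \bar R}) :
  (forall s G, s <= 0 -> measurable G -> m (gen s G) = 0%E) ->
  (forall s G, 0 < s -> measurable G -> m (gen s G) =
    (((1 - expR (- 2 * s)) / 2)%:E * weight mu t (angle_pull G))%E) ->
  forall B, measurable B -> m B = hit_law mu t B.
Proof.
move=> m0 mpos B mB.
pose C := gens.
have CE A : C A -> m A = hit_law mu t A.
  move=> [s [G [mG ->]]]; have [s0|s0] := leP s 0; first by rewrite m0// hit_law_le0.
  by rewrite mpos// hit_law_gen.
have eqT n : gen n%:R setT = [set x : mark | x.1.1 <= n%:R].
  by apply/seteqP; split=> x /=; [case|].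
apply: (measure_unique C (fun n => gen n%:R setT) _ _ _ _ m hit_measure) => //.
- exact: gens_generate.
- move=> _ _ [s1 [G1 [mG1 ->]]] [s2 [G2 [mG2 ->]]].
  exists (Num.min s1 s2), (G1 `&` G2); split; first exact: measurableI.
  apply/seteqP; split=> x /=; rewrite /gen /= le_min.
    by move=> [[-> ?] [-> ?]].
  by move=> [/andP[-> ->] []].
- by move=> n; exists n%:R, setT; split.
- apply/seteqP; split=> // x _.
  exists (Num.bound `|x.1.1|) => //; rewrite eqT/=.
  by apply: le_trans (ler_norm _) _; apply: ltW; exact: archi_boundP.
- move=> n; case: n => [|n]; first by rewrite m0// ltry.
  rewrite mpos// -ge0_fin_numE ?mule_ge0 ?measure_ge0//.
    by rewrite fin_numM// weight_fin//; exact: measurable_angle_pull.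
Qed.

End limit_law.

(** * Poisson processes: empty, occupied and finite regions *)

Section poisson.
Context (R : realType) (d : measure_display) (Omega : measurableType d)
  (P : probability Omega R) (d' : measure_display) (T : measurableType d')
  (E : set T) (Lambda : set T -> \bar R) (Z : Omega -> set T).
Hypothesis Z_poisson : poisson_process P E Lambda Z.
Implicit Types A : set T.
Local Open Scope ereal_scope.

Lemma npoints_eq0 A w : (npoints R Z A w = 0) <-> (Z w `&` A = set0).
Proof.
rewrite /npoints /counting; split=> [|->]; last by rewrite asboolT// fset_set0.
case: asboolP => // fA [] /eqP; rewrite pnatr_eq0 finmap.cardfs_eq0 => /eqP h.
by rewrite -(fset_setK fA) h set_fset0.
Qed.

Definition empty_event A : set Omega := [set w | npoints R Z A w = 0].

Lemma empty_eventN A w : (~` empty_event A) w <-> exists z, Z w z /\ A z.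
Proof.
split=> [h|[z [Zz Az]] /npoints_eq0 h].
  have /set0P[z [Zz Az]] : Z w `&` A != set0.
    by apply/eqP => /npoints_eq0.
  by exists z.
by have : (Z w `&` A) z by []; rewrite h.
Qed.

Lemma measurable_npoints_eq A (x : \bar R) : measurable A -> A `<=` E ->
  measurable [set w | npoints R Z A w = x].
Proof.
move=> mA AE; rewrite -[X in measurable X]setTI.
exact: (pp_measurable Z_poisson mA AE measurableT (emeasurable_set1 x)).
Qed.

Lemma measurable_empty_event A : measurable A -> A `<=` E ->
  measurable (empty_event A).
Proof. exact: measurable_npoints_eq. Qed.

Lemma probability_empty A : measurable A -> A `<=` E -> Lambda A < +oo ->
  P (empty_event A) = (expR (- fine (Lambda A)))%:E.
Proof.
move=> mA AE fA; have := pp_law Z_poisson mA AE fA 0.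
by rewrite expr0 fact0 divr1 mulr1.
Qed.

Lemma ae_empty A : measurable A -> A `<=` E -> Lambda A = 0 ->
  {ae P, forall w, forall z, Z w z -> ~ A z}.
Proof.
move=> mA AE A0; exists (~` empty_event A); split.
- by apply: measurableC; exact: measurable_empty_event.
- rewrite probability_setC ?probability_empty ?A0//= ?oppr0 ?expR0 ?subee//.
  exact: measurable_empty_event.
- move=> w /= h; apply/empty_eventN; apply: contrapT => nex; apply: h => z Zz Az.
  by apply: nex; exists z.
Qed.

Lemma ae_occupied A : measurable A -> A `<=` E -> Lambda A = +oo ->
  {ae P, forall w, exists z, Z w z /\ A z}.
Proof.
move=> mA AE Aoo; pose F := [set w | npoints R Z A w = +oo].
have mF : measurable F by exact: measurable_npoints_eq.
exists (~` F); split; first exact: measurableC.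
  by rewrite probability_setC// /F (pp_law_infty Z_poisson mA AE Aoo) subee.
move=> w /= h Fw; apply: h; apply/empty_eventN => e0.
by move: Fw; rewrite /F /= e0.
Qed.

Lemma ae_finite A : measurable A -> A `<=` E -> Lambda A < +oo ->
  {ae P, forall w, finite_set (Z w `&` A)}.
Proof.
move=> mA AE fA; pose F := [set w | npoints R Z A w = +oo].
have mF : measurable F by exact: measurable_npoints_eq.
exists F; split=> //; last first.
  move=> w /= h; rewrite /F/= /npoints /counting; case: asboolP => //.
set m := fine (Lambda A).
pose Fk k := [set w | npoints R Z A w = k%:R%:E].
have mFk k : measurable (Fk k) by exact: measurable_npoints_eq.
have tF : trivIset setT Fk.
  apply/trivIsetP => i j _ _ ij; apply/seteqP; split=> // w [/= wi wj].
  by have /eqP := etrans (esym wi) wj; rewrite eqe eqr_nat (negPf ij).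
(* The Poisson weights of [0, ..., n-1] already have a sum close to [1]. *)
have low n : (expR (- m) * series (exp_coeff m) n)%:E <= P (~` F).
  apply: (@le_trans _ _ (P (\big[setU/set0]_(k < n) Fk k))); last first.
    apply: le_measure.
    - by apply/mem_set/bigsetU_measurable.
    - by apply/mem_set/measurableC.
    - by rewrite -bigcup_mkord => w [k _ /= wk]; rewrite /F/= wk.
  rewrite measure_bigsetU//.
  rewrite /series/= big_mkord mulr_sumr -sumEFin.
  apply: lee_sum => k _; rewrite (pp_law Z_poisson mA AE fA k).
  by rewrite lee_fin /exp_coeff /= mulrA.
have one : 1 <= P (~` F).
  have fin : P (~` F) \is a fin_num.
    by apply: fin_num_measure; exact: measurableC.
  rewrite -(fineK fin) lee_fin.
  have lim : (expR (- m) * series (exp_coeff m) n @[n --> \oo] --> (1 : R))%R.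
    rewrite [X in _ --> X](_ : _ = expR (- m) * expR m)%R.
      by apply: cvgMl_tmp; exact: is_cvg_series_exp_coeff.
    by rewrite -expRD addNr expR0.
  apply: (cvgr_to_le lim); apply: nearW => n.
  by have := low n; rewrite -{1}(fineK fin) lee_fin.
have /eqP : P (~` F) = 1.
  apply/eqP; rewrite eq_le one andbT probability_le1//; exact: measurableC.
rewrite probability_setC// -[X in _ == X]sube0.
have fin : P F \is a fin_num by exact: fin_num_measure.
by rewrite -(fineK fin) -!EFinB eqe => /eqP h; congr EFin; lra.
Qed.

Lemma probability_empty_occupied A1 A2 : measurable A1 -> measurable A2 ->
  A1 `<=` E -> A2 `<=` E -> A1 `&` A2 = set0 ->
  P (empty_event A1 `&` ~` empty_event A2) =
  P (empty_event A1) * P (~` empty_event A2).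
Proof.
move=> mA1 mA2 A1E A2E A12.
pose A (i : 'I_2) := if i == ord0 then A1 else A2.
pose B (i : 'I_2) : set (\bar R) := if i == ord0 then [set 0] else ~` [set 0].
have mA i : measurable (A i) by rewrite /A; case: ifP.
have AE i : A i `<=` E by rewrite /A; case: ifP.
have AA i j : i != j -> A i `&` A j = set0.
  rewrite /A => ij; have [i0|ni] := eqVneq i ord0; have [j0|nj] := eqVneq j ord0.
  - by rewrite i0 j0 eqxx in ij.
  - by [].
  - by rewrite setIC.
  - by move: i j ij ni nj => [[|[|i]] hi] // [[|[|j]] hj] // /eqP[]; exact: val_inj.
have mB i : measurable (B i).
  by rewrite /B; case: ifP => _; [|apply: measurableC]; exact: emeasurable_set1.
have := pp_indep Z_poisson mA AE AA mB.
rewrite !big_ord_recl big_ord0 mule1 /= => <-; congr (P _).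
apply/seteqP; split=> w; first by move=> [h1 h2] i; rewrite /A /B; case: ifP.
by move=> h; split; [exact: (h ord0)|exact: (h (lift ord0 ord0))].
Qed.

End poisson.

(** * The first line met by the ray *)

Section first_line.
Context (R : realType).
Local Notation mark := (measurableTypeR R * measurableTypeR R *
                        measurableTypeR R)%type.
Implicit Types (S : set mark) (z : mark) (t : R)
  (G : set (measurableTypeR R * measurableTypeR R)).

(** Unlike [first_hit] this allows ties: existence then follows from local
    finiteness alone. *)
Definition minimal_hit S t z :=
  [/\ S z, 0 < cos (mark_theta z - t) &
      forall z', S z' -> 0 < cos (mark_theta z' - t) -> reach t z <= reach t z'].

Lemma cellP t (a b : R) G z : @mark_space R z -> cell t a b G z <->
  [/\ 0 < cos (mark_theta z - t), a < reach t z <= b &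
      G (mark_theta z, mark_radius z)].
Proof.
move=> Ez; split=> [[_ c0 /andP[h1 h2] Gz]|[c0 /andP[h1 h2] Gz]]; split=> //.
  by rewrite /reach ltr_pdivlMr// ler_pdivrMr// h1.
by rewrite -ltr_pdivlMr// -ler_pdivrMr//; apply/andP.
Qed.

Lemma reach_ge_rho t z : 0 < mark_rho z -> 0 < cos (mark_theta z - t) ->
  mark_rho z <= reach t z.
Proof. by move=> r0 c0; rewrite /reach ler_pdivlMr// ler_piMr ?(ltW r0) ?cos_le1. Qed.

Lemma exists_argmin (T : choiceType) (A : set T) (f : T -> R) (a : T) :
  finite_set A -> A a -> exists2 x, A x & forall y, A y -> f x <= f y.
Proof.
move=> /finite_seqP[r ->] ar.
have [x _ h] := arg_minP (fun x : seq_sub r => f (ssval x))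
  (isT : predT (SeqSub ar)).
exists (ssval x); first exact: ssvalP.
by move=> y yr; have := h (SeqSub yr) isT.
Qed.

Lemma exists_minimal_hit S t z0 : (forall z, S z -> 0 < mark_rho z) ->
  locally_finite S -> S z0 -> 0 < cos (mark_theta z0 - t) ->
  exists z, minimal_hit S t z.
Proof.
move=> rho0 finS Sz0 c0.
pose A := [set z | [/\ S z, 0 < cos (mark_theta z - t) & reach t z <= reach t z0]].
have finA : finite_set A.
  apply: sub_finite_set (finS (reach t z0)) => z [Sz cz lez]; split=> //.
  by apply: le_trans lez; apply: reach_ge_rho => //; exact: rho0.
have Az0 : A z0 by split.
have [z [Sz cz zz0] zmin] := exists_argmin (reach t) finA Az0.
exists z; split=> // z' Sz' cz'.
have [le'|lt'] := leP (reach t z') (reach t z0); first exact: zmin.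
by rewrite (le_trans zz0)// ltW.
Qed.

Lemma first_hit_minimal S t z : first_hit S t z -> minimal_hit S t z.
Proof.
move=> [Sz c0 h]; split=> // z' Sz' c'.
by have [->//|/eqP nz] := eqVneq z' z; rewrite ltW// h.
Qed.

Lemma first_hit_gap S t zh : (forall z, S z -> 0 < mark_rho z) ->
  locally_finite S -> first_hit S t zh -> exists2 e, 0 < e &
  forall z, S z -> z <> zh -> 0 < cos (mark_theta z - t) ->
    reach t zh + e < reach t z.
Proof.
move=> rho0 finS [Szh c0 hmin].
pose L := reach t zh.
have near_e : \forall e \near (0 : R)^'+, forall z, S z /\ mark_rho z <= L + 1 ->
    z <> zh -> 0 < cos (mark_theta z - t) -> L + e < reach t z.
  apply: (@near_finite _ _ (0^'+) _ _ (fun z e => z <> zh ->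
    0 < cos (mark_theta z - t) -> L + e < reach t z) (finS _)) => z [Sz _].
  have [[nz cz]|nc] := pselect (z <> zh /\ 0 < cos (mark_theta z - t)); last first.
    by near=> e => nz cz; exfalso; apply: nc.
  have gap : 0 < reach t z - L by rewrite subr_gt0; exact: hmin.
  near=> e => _ _; rewrite -ltrBrDl; near: e; exact: nbhs_right_lt.
have h : \forall e \near (0 : R)^'+, [/\ 0 < e, e < 1 &
    forall z, S z /\ mark_rho z <= L + 1 ->
    z <> zh -> 0 < cos (mark_theta z - t) -> L + e < reach t z].
  near=> e; split; near: e; [exact: nbhs_right_gt|exact: nbhs_right_lt|exact: near_e].
have [e [e0 e1 he]] := @filter_ex _ _ (at_right_proper_filter 0) _ h.
exists e => // z Sz nz cz.
have [le'|lt'] := leP (mark_rho z) (L + 1); first exact: he.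
apply: (lt_trans (y := L + 1)); first by rewrite ltrD2l.
by apply: lt_le_trans lt' _; apply: reach_ge_rho => //; exact: rho0.
Unshelve. all: by end_near. Qed.

Definition grid (s : R) (n k : nat) : R := s * k%:R / n.+1%:R.

Lemma grid_cell (s x : R) (n : nat) : 0 < s -> 0 < x <= s ->
  exists2 k, (k < n.+1)%N & grid s n k < x <= grid s n k.+1.
Proof.
move=> s0 /andP[x0 xs].
have ex : exists j, x <= grid s n j.
  by exists n.+1; rewrite /grid mulfK// pnatr_eq0.
have [j xj jmin] := ex_minnP ex; case: j xj jmin => [|k] xk kmin.
  by move: xk; rewrite /grid mulr0 mul0r leNgt x0.
exists k; last by rewrite xk andbT ltNge; apply/negP => /kmin; rewrite ltnn.
by apply: kmin; rewrite /grid mulfK// pnatr_eq0.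
Qed.

(** A discretization, with step [s / n.+1], of the fact that the first line is
    met before [s] and has its mark in [G]. It only involves the emptiness of
    disjoint regions, whose joint law is known for a Poisson process. *)
Definition grid_hit S t (s : R) G (n : nat) :=
  exists k, [/\ (k < n.+1)%N, forall z, S z -> ~ cell t 0 (grid s n k) setT z &
    exists z, S z /\ cell t (grid s n k) (grid s n k.+1) G z].

Section configuration.
Variables (S : set mark) (t s : R).
Hypotheses (SE : S `<=` @mark_space R) (rho_gt0 : forall z, S z -> 0 < mark_rho z)
  (s_gt0 : 0 < s).

Lemma reach_pos z : S z -> 0 < cos (mark_theta z - t) -> 0 < reach t z.
Proof. by move=> Sz c0; rewrite divr_gt0 ?rho_gt0. Qed.

Lemma minimal_grid_hit G z : minimal_hit S t z -> reach t z <= s ->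
  G (mark_theta z, mark_radius z) -> forall n, grid_hit S t s G n.
Proof.
move=> [Sz c0 zmin] zs Gz n.
have [|k kn /andP[k1 k2]] := grid_cell n s_gt0 (x := reach t z).
  by rewrite zs reach_pos.
exists k; split=> //; last by exists z; split=> //; apply/cellP; [exact: SE|rewrite k1].
move=> z' Sz' /(cellP _ _ _ _ (SE Sz'))[c' /andP[_ le'] _].
by have := le_lt_trans (le_trans (zmin _ Sz' c') le') k1; rewrite ltxx.
Qed.

(** As the grid is refined, the step containing the first abscissa eventually
    contains no other one. *)
Lemma grid_hitP G zh : locally_finite S -> first_hit S t zh ->
  (forall n, grid_hit S t s G n) <->
  reach t zh <= s /\ G (mark_theta zh, mark_radius zh).
Proof.
move=> finS hit; split=> [gh|[zs Gz]]; last first.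
  by apply: minimal_grid_hit zs Gz; exact: first_hit_minimal.
have [Szh c0 hmin] := hit.
have [e e0 gap] := first_hit_gap rho_gt0 finS hit.
have [n ltn] : exists n, s / n.+1%:R < e.
  exists (Num.bound (s / e)); rewrite ltr_pdivrMr// mulrC -ltr_pdivrMr//.
  apply: (@lt_trans _ _ (Num.bound (s / e))%:R); last by rewrite ltr_nat.
  by apply: archi_boundP; rewrite divr_ge0 ?ltW.
have [k [kn none [z [Sz /(cellP _ _ _ _ (SE Sz))[cz /andP[z1 z2] Gz]]]]] := gh n.
have lt_zh : grid s n k < reach t zh.
  rewrite ltNge; apply/negP => le_zh; apply: (none zh Szh).
  by apply/cellP; [exact: SE|split=> //; rewrite reach_pos].
have step : grid s n k.+1 = grid s n k + s / n.+1%:R.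
  by rewrite /grid -natr1 mulrDr mulr1 mulrDl.
have [zE|/eqP nz] := eqVneq z zh.
  subst z; split=> //; apply: le_trans z2 _.
  by rewrite /grid ler_pdivrMr// ler_pM2l// ler_nat.
have := gap z Sz nz cz; rewrite ltNge => /negP; case.
rewrite (le_trans z2)// step lerD// ltW//.
Qed.

End configuration.
End first_line.

Section geometric_bound.
Context (R : realType).

(** A geometric sum. As [n] grows the bound tends to
    [g / 2 * (1 - expR (- 2 * s))], the integral of [g * expR (- 2 * l)] over
    [`]0, s]]. *)
Lemma geometric_bound (s g : R) (n : nat) : 0 < s -> 0 <= g ->
  \sum_(k < n.+1) expR (- (2 * grid s n k)) * (1 - expR (- (g * (s / n.+1%:R))))
  <= g / 2 * (1 - expR (- 2 * s)) * (1 + 2 * s / n.+1%:R).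
Proof.
move=> s0 g0; set y := 2 * s / n.+1%:R.
have n0 : 0 < n.+1%:R :> R by [].
have y0 : 0 < y by rewrite divr_gt0// mulr_gt0.
set q := expR (- y).
have q0 : 0 < q by rewrite expR_gt0.
have q1 : q < 1 by rewrite -expR0 ltr_expR oppr_lt0.
rewrite -mulr_suml.
have -> : \sum_(k < n.+1) expR (- (2 * grid s n k)) = (1 - expR (- 2 * s)) / (1 - q).
  have geo : (1 - q) * \sum_(k < n.+1) q ^+ k = 1 - q ^+ n.+1.
    by have := subrX1 q n.+1 => h; rewrite -[RHS]opprB h -mulNr opprB.
  have -> : expR (- 2 * s) = q ^+ n.+1.
    rewrite -expRM_natl; congr expR; rewrite mulrN /y mulrCA mulfV ?gt_eqF//.
    by rewrite mulr1 mulNr.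
  rewrite -geo mulrC mulKf ?gt_eqF ?subr_gt0//; apply: eq_bigr => k _.
  by rewrite -expRM_natl; congr expR; rewrite /grid /y; field; rewrite gt_eqF.
have h1 : 1 - expR (- (g * (s / n.+1%:R))) <= g / 2 * y.
  rewrite (_ : g / 2 * y = g * (s / n.+1%:R)); last by rewrite /y; field; rewrite gt_eqF.
  by rewrite lerBlDr addrC -lerBlDr; exact: expR_ge1Dx.
have h2 : (1 - q)^-1 <= (1 + y) / y.
  have y1 : 0 < 1 + y by rewrite addr_gt0.
  have y2 : 0 < y / (1 + y) by apply: divr_gt0.
  rewrite -[leRHS]invf_div lef_pV2 ?posrE ?subr_gt0//.
  have qy : q * (1 + y) <= 1.
    rewrite /q expRN mulrC ler_pdivrMr ?expR_gt0// mul1r; exact: expR_ge1Dx.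
  by rewrite ler_pdivrMr//; lra.
have a0 : 0 <= 1 - expR (- 2 * s).
  by rewrite subr_ge0 -[leRHS]expR0 ler_expR mulNr oppr_le0 mulr_ge0// ltW.
apply: (@le_trans _ _ ((1 - expR (- 2 * s)) * ((1 + y) / y) * (g / 2 * y))).
  apply: ler_pM => //.
  - by apply: divr_ge0 => //; rewrite subr_ge0; exact: ltW.
  - rewrite subr_ge0 -[leRHS]expR0 ler_expR oppr_le0 mulr_ge0// divr_ge0// ltW//.
  - by rewrite ler_wpM2l.
rewrite le_eqVlt; apply/orP; left; apply/eqP; field.
by rewrite gt_eqF.
Qed.

End geometric_bound.

(** * Almost sure regularity of the Poisson process *)

Section poisson_marks.
Context (R : realType) (mu : probability (measurableTypeR R) R) (Rstar : R).
Hypotheses (mu_nonneg : mu [set r : R | 0 <= r] = 1%E)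
  (mu_Rstar : mu [set r : R | Rstar < r] = 1%E).
Context (d : measure_display) (Omega : measurableType d) (P : probability Omega R).
Local Notation mark := (measurableTypeR R * measurableTypeR R *
                        measurableTypeR R)%type.
Context (Z : Omega -> set mark).
Hypothesis Z_poisson : poisson_process P (@mark_space R) (intensity mu) Z.
Local Notation leb := (@lebesgue_measure R).

Let nonneg : set (measurableTypeR R) := `[0, +oo[%classic.
Let turn : set (measurableTypeR R) := `[0, 2 * pi[%classic.

Let measurable_nonneg : measurable nonneg.
Proof. exact: measurable_itv. Qed.

Let measurable_turn : measurable turn.
Proof. exact: measurable_itv. Qed.

Let mu_nonneg1 : mu nonneg = 1%E.
Proof.
rewrite -mu_nonneg; congr (mu _); apply/seteqP.
by split=> x; rewrite /nonneg /= in_itv/= andbT.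
Qed.

Lemma intensity_box (A B C : set (measurableTypeR R)) :
  measurable A -> measurable B -> measurable C ->
  intensity mu ((A `*` B) `*` C) = (leb A * leb B * mu C)%E.
Proof.
move=> mA mB mC; rewrite /intensity product_measure1E//; last exact: measurableX.
by congr (_ * _)%E; exact: product_measure1E.
Qed.

Lemma box_sub (A B C : set (measurableTypeR R)) :
  A `<=` nonneg -> B `<=` turn -> C `<=` nonneg ->
  (A `*` B) `*` C `<=` @mark_space R.
Proof.
move=> hA hB hC [[a b] c] [[/= /hA + /hB +] /hC].
by rewrite /nonneg /turn /= !in_itv/= !andbT.
Qed.

Lemma ae_rho_gt0 : {ae P, forall w, forall z, Z w z -> 0 < mark_rho z}.
Proof.
pose A : set (measurableTypeR R) := [set 0].
have mA : measurable A by exact: measurable_set1.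
have box0 : intensity mu ((A `*` turn) `*` nonneg) = 0%E.
  by rewrite intensity_box// [leb A]lebesgue_measure_set1 !mul0e.
have sub : (A `*` turn) `*` nonneg `<=` @mark_space R.
  by apply: box_sub => // x ->; rewrite /nonneg/= in_itv/= lexx.
have mbox : measurable ((A `*` turn) `*` nonneg).
  by apply: measurableX => //; exact: measurableX.
apply: filterS (ae_empty Z_poisson mbox sub box0) => w h z Zz.
have [rho0 th r0] := pp_sub Z_poisson Zz.
rewrite lt_neqAle rho0 andbT; apply/negP => /eqP rhoE; apply: (h z Zz).
by split; [split|] => //=; rewrite ?/turn ?/nonneg /= in_itv/= ?andbT.
Qed.

Lemma ae_radius : {ae P, forall w, forall z, Z w z -> Rstar < mark_radius z}.
Proof.
pose C : set (measurableTypeR R) := nonneg `&` ~` [set r | Rstar < r].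
have mR : measurable ([set r | Rstar < r] : set (measurableTypeR R)).
  rewrite (_ : [set r | Rstar < r] = `]Rstar, +oo[%classic)//.
  by apply/seteqP; split=> x /=; rewrite in_itv/= andbT.
have mC : measurable C by apply: measurableI => //; exact: measurableC.
have C0 : mu C = 0%E.
  apply/eqP; rewrite -measure_le0.
  apply: (@le_trans _ _ (mu (~` [set r | Rstar < r]))).
    apply: le_measure; [exact/mem_set|exact/mem_set/measurableC|].
    by move=> x [].
  by rewrite probability_setC// mu_Rstar subee.
have box0 : intensity mu ((nonneg `*` turn) `*` C) = 0%E.
  by rewrite intensity_box// C0 mule0.
have sub : (nonneg `*` turn) `*` C `<=` @mark_space R.
  by apply: box_sub => // x [].
have mbox : measurable ((nonneg `*` turn) `*` C).
  by apply: measurableX => //; exact: measurableX.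
apply: filterS (ae_empty Z_poisson mbox sub box0) => w h z Zz.
have [rho0 th r0] := pp_sub Z_poisson Zz.
rewrite ltNge; apply/negP => rR; apply: (h z Zz).
split; first by split=> /=; rewrite ?/turn ?/nonneg /= in_itv/= ?andbT.
split; first by rewrite /nonneg /= in_itv/= andbT.
by rewrite /= ltNge; apply/negP; rewrite negbK.
Qed.

Lemma ae_locally_finite : {ae P, forall w, locally_finite (Z w)}.
Proof.
pose A (n : nat) : set (measurableTypeR R) := `[0, n%:R]%classic.
have mA n : measurable (A n) by exact: measurable_itv.
have boxn n : (intensity mu ((A n `*` turn) `*` nonneg) < +oo)%E.
  rewrite intensity_box// [mu _]mu_nonneg1 mule1.
  rewrite /A /turn !lebesgue_measure_itv/= !lte_fin.
  by case: ifP => _; case: ifP => _; rewrite ?mule0 ?mul0e ?ltry// -!EFinB -EFinM ltry.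
have sub n : (A n `*` turn) `*` nonneg `<=` @mark_space R.
  apply: box_sub => // x; rewrite /A /nonneg /= !in_itv/= andbT.
  by case/andP.
have mbox n : measurable ((A n `*` turn) `*` nonneg).
  by apply: measurableX => //; exact: measurableX.
have := ae_foralln (fun n => ae_finite Z_poisson (mbox n) (sub n) (boxn n)).
apply: filterS => w fin M.
apply: sub_finite_set (fin (Num.bound `|M|)) => z [Zz zM]; split=> //.
have [rho0 th r0] := pp_sub Z_poisson Zz.
split; last by rewrite /nonneg /= in_itv/= andbT.
split=> /=; rewrite ?/A ?/turn /= in_itv//= [_ <= _]rho0/=.
apply: le_trans zM _; apply: le_trans (ler_norm M) _.
by apply: ltW; exact: archi_boundP.
Qed.

(** The marks with polar angle in a given interval have infinite intensity,
    the distance to the line being unbounded. *)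
Lemma ae_direction (g : R -> R) (theta0 : R) : continuous g ->
  0 <= theta0 < 2 * pi -> 1 / 2 < g theta0 ->
  {ae P, forall w, exists2 z, Z w z & 1 / 2 <= g (mark_theta z)}.
Proof.
move=> cg /andP[th0 th1] g0.
have : \forall x \near theta0, 1 / 2 < g x by exact: (cvgr_gt _ (cg theta0)).
move=> /nbhs_ballP[e /= e0 ball_g].
pose u := Num.min (theta0 + e) (2 * pi).
have lt_u : theta0 < u by rewrite lt_min ltrDl e0.
pose B : set (measurableTypeR R) := `[theta0, u[%classic.
have mB : measurable B by exact: measurable_itv.
have boxoo : intensity mu ((nonneg `*` B) `*` nonneg) = +oo%E.
  rewrite intensity_box// [mu _]mu_nonneg1 mule1 /nonneg /B.
  rewrite !lebesgue_measure_itv/= ltry lte_fin lt_u oppr0 adde0.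
  by rewrite gt0_mulye// -EFinB lte_fin subr_gt0.
have sub : (nonneg `*` B) `*` nonneg `<=` @mark_space R.
  apply: box_sub => // x; rewrite /B /turn /= !in_itv/= => /andP[h1 h2].
  by rewrite (le_trans th0 h1) (lt_le_trans h2)// ge_min lexx orbT.
have mbox : measurable ((nonneg `*` B) `*` nonneg).
  by apply: measurableX => //; exact: measurableX.
apply: filterS (ae_occupied Z_poisson mbox sub boxoo) => w [z [Zz [[_ /= Bz] _]]].
exists z => //; apply/ltW/ball_g; rewrite /ball/= ltr_norml.
move: Bz; rewrite /B /= in_itv/= => /andP[h1 h2].
have h3 : mark_theta z < theta0 + e by rewrite (lt_le_trans h2)// ge_min lexx.
by apply/andP; split; rewrite /mark_theta in h3 *; lra.
Qed.

Lemma half_dominant (a b c s : R) : `|b| <= a -> 1 / 2 <= c - `|s| ->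
  a <= 2 * (a * c + b * s).
Proof.
move=> ba cs; have a0 : 0 <= a by exact: le_trans ba.
have bs : - (a * `|s|) <= b * s.
  rewrite lerNl (le_trans (ler_norm _))// normrN normrM.
  by rewrite ler_wpM2r.
have h : a * (1 / 2) <= a * (c - `|s|) by rewrite ler_wpM2l.
by move: h; rewrite mulrBr; lra.
Qed.

(** Four marks with polar angles close to the four axes surround the origin. *)
Lemma ae_surrounded : {ae P, forall w, surrounded (Z w)}.
Proof.
have p0 := pi_gt0 R.
have cc := @continuous_cos R; have cs := @continuous_sin R.
have cn (f : R -> R) : continuous f -> continuous (fun x => `|f x|).
  by move=> cf x; apply: continuous_comp; [exact: cf|exact: norm_continuous].
have e1 : {ae P, forall w, exists2 z, Z w z &
    1 / 2 <= cos (mark_theta z) - `|sin (mark_theta z)|}.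
  apply: (@ae_direction (fun x => cos x - `|sin x|) 0).
  - by move=> x; apply: cvgB; [exact: cc|exact: (cn _ cs)].
  - by rewrite lexx mulr_gt0.
  - by rewrite cos0 sin0 normr0; lra.
have e2 : {ae P, forall w, exists2 z, Z w z &
    1 / 2 <= sin (mark_theta z) - `|cos (mark_theta z)|}.
  apply: (@ae_direction (fun x => sin x - `|cos x|) (pi / 2)).
  - by move=> x; apply: cvgB; [exact: cs|exact: (cn _ cc)].
  - by apply/andP; split; lra.
  - by rewrite cos_pihalf sin_pihalf normr0; lra.
have e3 : {ae P, forall w, exists2 z, Z w z &
    1 / 2 <= - cos (mark_theta z) - `|sin (mark_theta z)|}.
  apply: (@ae_direction (fun x => - cos x - `|sin x|) pi).
  - by move=> x; apply: cvgB; [apply: cvgN; exact: cc|exact: (cn _ cs)].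
  - by apply/andP; split; lra.
  - by rewrite cospi sinpi normr0; lra.
have e4 : {ae P, forall w, exists2 z, Z w z &
    1 / 2 <= - sin (mark_theta z) - `|cos (mark_theta z)|}.
  apply: (@ae_direction (fun x => - sin x - `|cos x|) (pi / 2 + pi)).
  - by move=> x; apply: cvgB; [apply: cvgN; exact: cs|exact: (cn _ cc)].
  - by apply/andP; split; lra.
  - by rewrite cosDpi sinDpi cos_pihalf sin_pihalf oppr0 normr0; lra.
apply: filterS (filterI ae_rho_gt0 (filterI (filterI e1 e2) (filterI e3 e4))).
move=> w [rho0 [[[z1 Z1 h1] [z2 Z2 h2]] [[z3 Z3 h3] [z4 Z4 h4]]]].
have r1 := rho0 _ Z1; have r2 := rho0 _ Z2.
have r3 := rho0 _ Z3; have r4 := rho0 _ Z4.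
exists (mark_rho z1 + mark_rho z2 + mark_rho z3 + mark_rho z4) => y.
rewrite prod_normE /dotu.
have [y21|/ltW y12] := leP `|y.2| `|y.1|.
  have [y0|y0] := leP 0 y.1.
    exists z1; split=> //; first lra.
    by rewrite ger0_norm//; apply: half_dominant => //; rewrite -(ger0_norm y0).
  exists z3; split=> //; first lra.
  rewrite ltr0_norm// (_ : y.1 * _ = - y.1 * - cos (mark_theta z3)); last by ring.
  by apply: half_dominant => //; rewrite -(ltr0_norm y0).
have [y0|y0] := leP 0 y.2.
  exists z2; split=> //; first lra.
  by rewrite ger0_norm// addrC; apply: half_dominant => //; rewrite -(ger0_norm y0).
exists z4; split=> //; first lra.
rewrite ltr0_norm// addrC (_ : y.2 * _ = - y.2 * - sin (mark_theta z4)); last by ring.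
by apply: half_dominant => //; rewrite -(ltr0_norm y0).
Qed.

End poisson_marks.

(** * The law of the first line *)

Section first_line_law.
Context (R : realType) (mu : probability (measurableTypeR R) R) (Rstar : R).
Hypotheses (mu_nonneg : mu [set r : R | 0 <= r] = 1%E)
  (mu_Rstar : mu [set r : R | Rstar < r] = 1%E).
Context (d : measure_display) (Omega : measurableType d) (P : probability Omega R).
Local Notation mark := (measurableTypeR R * measurableTypeR R *
                        measurableTypeR R)%type.
Context (Z : Omega -> set mark).
Hypothesis Z_poisson : poisson_process P (@mark_space R) (intensity mu) Z.
Variable t : R.
Hypothesis t_range : 0 <= t < 2 * pi.
Implicit Types G : set (measurableTypeR R * measurableTypeR R).

Local Notation weight := (weight mu t).

Lemma weight_ge0 G : (0 <= weight G)%E.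
Proof. exact: measure_ge0. Qed.

Lemma fine_weightC G : measurable G ->
  fine (weight G) + fine (weight (~` G)) = 2.
Proof.
move=> mG; have := weightC mu t mG; rewrite (weightT mu_nonneg t_range).
have f1 := weight_fin mu_nonneg t_range mG.
have f2 := weight_fin mu_nonneg t_range (measurableC mG).
by rewrite -(fineK f1) -(fineK f2) -EFinD => -[].
Qed.

Lemma fine_intensity_cell (a b : R) G : 0 <= a <= b -> measurable G ->
  (intensity mu (cell t a b G) < +oo)%E /\
  fine (intensity mu (cell t a b G)) = (b - a) * fine (weight G).
Proof.
move=> ab mG; rewrite intensity_cell//.
have f1 := weight_fin mu_nonneg t_range mG.
by rewrite -(fineK f1) -EFinM ltry.
Qed.

Definition step_event s G n k : set Omega :=
  empty_event R Z (cell t 0 (grid s n k) setT) `&`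
  ~` empty_event R Z (cell t (grid s n k) (grid s n k.+1) G).

Definition grid_event s G n : set Omega := [set w | grid_hit (Z w) t s G n].

Definition limit_event s G : set Omega := \bigcap_n grid_event s G n.

Lemma grid_eventE s G n :
  grid_event s G n = \big[setU/set0]_(k < n.+1) step_event s G n k.
Proof.
rewrite -bigcup_mkord; apply/seteqP; split=> w.
  move=> [k [kn none occ]]; exists k => //; split; last exact/empty_eventN.
  apply/npoints_eq0; apply/seteqP; split=> // z [Zz cz]; exact: (none z Zz).
move=> [k /= kn [/npoints_eq0 e /empty_eventN occ]]; exists k; split=> // z Zz cz.
by have : (Z w `&` cell t 0 (grid s n k) setT) z by []; rewrite e.
Qed.

Let measurable_empty (a b : R) G : measurable G ->
  measurable (empty_event R Z (cell t a b G)).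
Proof.
move=> mG; apply: (measurable_empty_event Z_poisson); first exact: measurable_cell.
exact: cell_sub.
Qed.

Lemma measurable_step_event s G n k : measurable G ->
  measurable (step_event s G n k).
Proof.
move=> mG; apply: measurableI; first exact: measurable_empty.
by apply: measurableC; exact: measurable_empty.
Qed.

Lemma measurable_grid_event s G n : measurable G ->
  measurable (grid_event s G n).
Proof.
move=> mG; rewrite grid_eventE; apply: bigsetU_measurable => k _.
exact: measurable_step_event.
Qed.

Lemma measurable_limit_event s G : measurable G ->
  measurable (limit_event s G).
Proof. by move=> mG; apply: bigcap_measurable => // n _; exact: measurable_grid_event. Qed.

Lemma grid_ge0 (s : R) n k : 0 < s -> 0 <= grid s n k.
Proof. by move=> s0; rewrite /grid divr_ge0// mulr_ge0// ltW. Qed.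

Lemma grid_step (s : R) n k : 0 < s -> 0 <= grid s n k <= grid s n k.+1.
Proof.
move=> s0; rewrite grid_ge0//= /grid ler_pM2r ?invr_gt0// ler_pM2l// ler_nat//.
Qed.

Lemma probability_step_event s G n k : 0 < s -> measurable G ->
  P (step_event s G n k) = (expR (- (2 * grid s n k)) *
    (1 - expR (- (fine (weight G) * (s / n.+1%:R)))))%:E.
Proof.
move=> s0 mG.
have gk0 : (0 : R) <= 0 <= grid s n k by rewrite lexx grid_ge0.
have [fT eT] := fine_intensity_cell gk0 measurableT.
have [fG eG] := fine_intensity_cell (grid_step n k s0) mG.
have mT : measurable (cell t 0 (grid s n k) setT) by exact: measurable_cell.
have mC : measurable (cell t (grid s n k) (grid s n k.+1) G).
  exact: measurable_cell.
have subT : cell t 0 (grid s n k) setT `<=` @mark_space R by exact: cell_sub.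
have subC : cell t (grid s n k) (grid s n k.+1) G `<=` @mark_space R.
  exact: cell_sub.
rewrite /step_event (probability_empty_occupied Z_poisson mT mC)//; last first.
  apply/seteqP; split=> // z [[_ _ /andP[_ h1] _] [_ _ /andP[h2 _] _]].
  by have := le_lt_trans h1 h2; rewrite ltxx.
rewrite probability_setC; last exact: measurable_empty.
rewrite (probability_empty Z_poisson mT)// (probability_empty Z_poisson mC)//.
rewrite eT eG (weightT mu_nonneg t_range) subr0 /= -EFinB -EFinM.
congr (expR (- _) * (1 - expR (- _)))%:E; first by rewrite mulrC.
rewrite mulrC; congr (_ * _); rewrite /grid -natr1 mulrDr mulr1 mulrDl.
by rewrite addrAC subrr add0r.
Qed.

(** A union bound over the steps of the grid, each step event being the
    intersection of two independent events. *)
Lemma probability_limit_event_le s G : 0 < s -> measurable G ->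
  fine (P (limit_event s G)) <= fine (weight G) / 2 * (1 - expR (- 2 * s)).
Proof.
move=> s0 mG; set g := fine (weight G); set c := g / 2 * _.
have g0 : 0 <= g by exact: fine_ge0 (weight_ge0 G).
have mL := measurable_limit_event s mG.
have le_n n : fine (P (limit_event s G)) <= c * (1 + 2 * s * harmonic n).
  rewrite -lee_fin fineK; last exact: fin_num_measure.
  apply: (@le_trans _ _ (P (grid_event s G n))).
    apply: le_measure; [exact/mem_set|exact/mem_set/measurable_grid_event|].
    by move=> w; apply.
  rewrite grid_eventE.
  apply: le_trans (Boole_inequality P _) _.
    by move=> k _; exact: measurable_step_event.
  apply: (@le_trans _ _ (\sum_(k < n.+1) (expR (- (2 * grid s n k)) *
      (1 - expR (- (g * (s / n.+1%:R)))))%:E)%E).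
    by apply: lee_sum => k _; rewrite -(@probability_step_event s G n k s0 mG).
  by rewrite sumEFin lee_fin /harmonic /=; exact: geometric_bound.
have lim : c * (1 + 2 * s * harmonic n) @[n --> \oo] --> c.
  rewrite -[X in _ --> X]mulr1 -[X in _ --> c * X]addr0 -[X in _ --> c * (1 + X)](mulr0 (2 * s)).
  apply: cvgMl_tmp; apply: cvgD; first exact: cvg_cst.
  by apply: cvgMl_tmp; exact: cvg_harmonic.
by apply: (cvgr_to_ge lim); exact: nearW.
Qed.

Let regular w := [/\ forall z, Z w z -> 0 < mark_rho z,
  forall z, Z w z -> Rstar < mark_radius z,
  locally_finite (Z w) & surrounded (Z w)].

Lemma ae_regular : {ae P, forall w, regular w}.
Proof.
have h1 := ae_rho_gt0 Z_poisson; have h2 := ae_radius mu_Rstar Z_poisson.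
have h3 := ae_locally_finite mu_nonneg Z_poisson.
have h4 := ae_surrounded mu_nonneg Z_poisson.
by apply: filterS (filterI (filterI h1 h2) (filterI h3 h4)) => w [[? ?] [? ?]]; split.
Qed.

(** If some line is met before [s] then so is a first one, whose mark is in [G]
    or in its complement. *)
Lemma limit_event_cover s G : {ae P, forall w,
  (exists z, Z w z /\ cell t 0 s setT z) -> (limit_event s G `|` limit_event s (~` G)) w}.
Proof.
apply: filterS ae_regular => w [rho0 _ finS _] [z0 [Zz0 cz0]].
have ZE := pp_sub Z_poisson (w := w).
have [c0 /andP[_ z0s] _] := (cellP t 0 s setT (ZE _ Zz0)).1 cz0.
have [z zmin] := exists_minimal_hit rho0 finS Zz0 c0.
have [Zz cz zle] := zmin.
have zs : reach t z <= s by exact: le_trans (zle _ Zz0 c0) z0s.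
have s0 : 0 < s by apply: lt_le_trans zs; rewrite divr_gt0 ?rho0.
have [Gz|nGz] := pselect (G (mark_theta z, mark_radius z)); [left|right];
  by move=> n _; exact: (minimal_grid_hit ZE rho0 s0 zmin zs).
Qed.

(** The two upper bounds add up to the probability of the event covered by the
    union: both are equalities and the intersection is negligible. *)
Lemma limit_event_law s G : 0 < s -> measurable G ->
  P (limit_event s G) = ((1 - expR (- 2 * s)) / 2 * fine (weight G))%:E /\
  P (limit_event s G `&` limit_event s (~` G)) = 0%E.
Proof.
move=> s0 mG; have mGC := measurableC mG.
set V := limit_event s G; set W := limit_event s (~` G).
have mV : measurable V by exact: measurable_limit_event.
have mW : measurable W by exact: measurable_limit_event.
have [N [mN N0 NS]] := limit_event_cover s G.
have hV := probability_limit_event_le s0 mG.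
have hW := probability_limit_event_le s0 mGC.
have gg := fine_weightC mG.
have H : 1 - expR (- 2 * s) <= fine (P V) + fine (P (W `\` V)).
  have s00 : (0 : R) <= 0 <= s by rewrite lexx ltW.
  have [fT eT] := fine_intensity_cell s00 measurableT.
  have mT : measurable (cell t 0 s setT) by exact: measurable_cell.
  have PH : P (~` empty_event R Z (cell t 0 s setT)) = (1 - expR (- 2 * s))%:E.
    rewrite probability_setC; last exact: measurable_empty.
    rewrite (probability_empty Z_poisson mT)//; last exact: cell_sub.
    rewrite eT (weightT mu_nonneg t_range) subr0 /= -EFinB.
    by congr (1 - expR _)%:E; rewrite mulrC mulNr.
  rewrite -lee_fin -PH EFinD !fineK; last 2 first.
  - by apply: fin_num_measure; exact: measurableD.
  - exact: fin_num_measure.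
  rewrite -measureU//; last 2 first.
  - exact: measurableD.
  - by apply/seteqP; split=> // w [? []].
  have -> : V `|` W `\` V = V `|` W.
    apply/seteqP; split=> w; first by case=> [|[]]; [left|right].
    by have [|nV] := pselect (V w); [left|case=> //; right].
  apply: (@le_trans _ _ (P ((V `|` W) `|` N))).
    apply: le_measure; [apply/mem_set/measurableC; exact: measurable_empty| |].
      by apply/mem_set; apply: measurableU => //; exact: measurableU.
    move=> w /empty_eventN occ; have [|nVW] := pselect ((V `|` W) w); first by left.
    by right; apply: NS => /(_ occ).
  have mVW : measurable (V `|` W) by exact: measurableU.
  by rewrite -[leRHS]adde0 -[X in (_ + X)%E]N0; exact: measureU2.
have W2 : fine (P W) = fine (P (W `\` V)) + fine (P (W `&` V)).
  rewrite -fineD ?fin_num_measure//; first by rewrite -measureDI.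
  - exact: measurableD.
  - exact: measurableI.
have i0 : 0 <= fine (P (W `&` V)) by rewrite fine_ge0.
have a0 : 0 < 1 - expR (- 2 * s).
  by rewrite subr_gt0 -[ltRHS]expR0 ltr_expR; nra.
have gW : fine (weight (~` G)) = 2 - fine (weight G) by lra.
rewrite gW in hW.
split.
  rewrite -[LHS]fineK ?fin_num_measure//; congr EFin.
  apply/eqP; rewrite eq_le; apply/andP; split; nra.
rewrite setIC -[LHS]fineK ?fin_num_measure//; last exact: measurableI.
by congr EFin; apply/eqP; rewrite eq_le i0 andbT; nra.
Qed.

Lemma ae_no_tie s G : 0 < s -> measurable G -> {ae P, forall w,
  ~ ((forall n, grid_hit (Z w) t s G n) /\ (forall n, grid_hit (Z w) t s (~` G) n))}.
Proof.
move=> s0 mG; have [_ h] := limit_event_law s0 mG.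
exists (limit_event s G `&` limit_event s (~` G)); split=> //.
  by apply: measurableI; apply: measurable_limit_event => //; exact: measurableC.
by move=> w /= hw; have [h1 h2] := contrapT hw;
  split=> n _; [exact: h1|exact: h2].
Qed.

(** Two distinct points with the same abscissa differ by their angle or by
    their radius, and are then separated by one of countably many half-planes. *)
Lemma ae_first_hit : {ae P, forall w, exists zh, first_hit (Z w) t zh}.
Proof.
pose Ga (x : R) : set (measurableTypeR R * measurableTypeR R) := [set p | p.1 <= x].
pose Gr (x : R) : set (measurableTypeR R * measurableTypeR R) := [set p | p.2 <= x].
have mGa x : measurable (Ga x).
  by apply: measurable_pred; apply: measurable_fun_ler; [exact: measurable_fst|exact: measurable_cst].
have mGr x : measurable (Gr x).
  by apply: measurable_pred; apply: measurable_fun_ler; [exact: measurable_snd|exact: measurable_cst].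
pose q (k : nat) : R := ratr (odflt 0 (unpickle k : option rat)).
pose tie G (n : nat) w := (forall m, grid_hit (Z w) t n.+1%:R G m) /\
  (forall m, grid_hit (Z w) t n.+1%:R (~` G) m).
have tieA : {ae P, forall w, forall n k, ~ tie (Ga (q k)) n w}.
  by apply: ae_foralln => n; apply: ae_foralln => k; apply: ae_no_tie.
have tieR : {ae P, forall w, forall n k, ~ tie (Gr (q k)) n w}.
  by apply: ae_foralln => n; apply: ae_foralln => k; apply: ae_no_tie.
apply: filterS (filterI ae_regular (filterI tieA tieR)) => w [[rho0 _ finS sur] [nA nR]].
have ZE := pp_sub Z_poisson (w := w).
have [M sur'] := sur; have [z0 [Zz0 _ dz0]] := sur' (polar 1 t).
have c0 : 0 < cos (mark_theta z0 - t).
  move: dz0; rewrite dotu_polar mul1r => dz0.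
  have n0 : 0 < `|polar 1 t|.
    rewrite normr_gt0; apply/negP => /eqP p0; have := enorm_polar t (@ler01 R).
    rewrite p0 /enorm /= !expr0n/= addr0 sqrtr0 => /eqP.
    by rewrite eq_sym oner_eq0.
  by have := lt_le_trans n0 dz0; rewrite pmulr_rgt0.
have [zh hmin] := exists_minimal_hit rho0 finS Zz0 c0.
have separated z1 z2 (f : mark -> R) (G : R -> set (measurableTypeR R * measurableTypeR R)) :
    (forall n k, ~ tie (G (q k)) n w) ->
    (forall x z, G x (mark_theta z, mark_radius z) <-> f z <= x) ->
    minimal_hit (Z w) t z1 -> minimal_hit (Z w) t z2 -> ~ f z1 < f z2.
  move=> nG GE h1 h2 /rat_in_itvoo[x]; rewrite in_itv/= => /andP[x1 x2].
  have [Z1 c1 l1] := h1; have [Z2 c2 l2] := h2.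
  pose n := Num.bound `|reach t z1|.
  have r1 : reach t z1 <= n.+1%:R.
    apply: le_trans (ler_norm _) _; apply: ltW.
    apply: (@lt_trans _ _ n%:R); first exact: archi_boundP.
    by rewrite ltr_nat.
  have r2 : reach t z2 <= n.+1%:R by exact: le_trans (l2 _ Z1 c1) r1.
  have qx : q (pickle x) = ratr x by rewrite /q pickleK.
  apply: (nG n (pickle x)); rewrite qx; split.
    apply: (minimal_grid_hit ZE rho0 _ h1 r1) => //.
    by apply/GE; exact: ltW.
  apply: (minimal_grid_hit ZE rho0 _ h2 r2) => //.
  by move=> /GE; rewrite leNgt x2.
have uniq z1 z2 : minimal_hit (Z w) t z1 -> minimal_hit (Z w) t z2 -> z1 = z2.
  move=> h1 h2.
  have th : mark_theta z1 = mark_theta z2.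
    apply/eqP; rewrite eq_le !leNgt; apply/andP; split; apply/negP;
      by apply: (separated _ _ (@mark_theta R) Ga).
  have ra : mark_radius z1 = mark_radius z2.
    apply/eqP; rewrite eq_le !leNgt; apply/andP; split; apply/negP;
      by apply: (separated _ _ (@mark_radius R) Gr).
  have [Z1 c1 l1] := h1; have [Z2 c2 l2] := h2.
  have : reach t z1 = reach t z2.
    by apply/eqP; rewrite eq_le l1//= l2.
  rewrite /reach th => /(mulIf _) rh.
  have {}rh : mark_rho z1 = mark_rho z2 by apply: rh; rewrite invr_eq0 gt_eqF.
  by move: th ra rh; rewrite /mark_theta /mark_radius /mark_rho;
    case: z1 z2 {h1 h2 Z1 c1 l1 Z2 c2 l2} => [[? ?] ?] [[? ?] ?] /= -> -> ->.
have [Zh ch lh] := hmin; exists zh; split=> // z Zz nz cz.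
rewrite lt_neqAle lh// andbT; apply/negP => /eqP e; apply: nz.
apply: uniq => //; split=> // z' Zz' cz'; rewrite -e; exact: lh.
Qed.

(** All the almost sure properties hold off one measurable null set [N]; there the
    preimages of the sets [gen s G] are limit events, which gives measurability
    and the law at once. *)
Lemma hit_triple_law : has_law P (fun w => hit_triple (Z w) t) (hit_law mu t).
Proof.
have [N [mN N0 NS]] := filterI ae_regular ae_first_hit.
have good w : ~ N w -> regular w /\ exists zh, first_hit (Z w) t zh.
  by move=> nN; apply: contrapT => h; apply: nN; apply: NS.
(* Any constant value on [N] makes this measurable. *)
pose Y w : mark := if `[< N w >] then (0, 0, 0) else hit_triple (Z w) t.
have Y_gen s G : measurable G -> ~` N `&` Y @^-1` gen s G =
    if 0 < s then ~` N `&` limit_event s (angle_pull t G) else set0.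
  move=> mG; apply/seteqP; split=> w.
    move=> [nN]; rewrite /preimage /= /Y asboolF//.
    have [[rho0 rad0 finS sur] [zh hit]] := good _ nN.
    have ZE := pp_sub Z_poisson (w := w).
    rewrite /hit_triple /Lhit /Upsilon /Theta /Radius (hit_markE rho0 finS hit).
    move=> [/= Ls Gz]; have L0 := reach_gt0 rho0 hit.
    have s0 : 0 < s by exact: lt_le_trans Ls.
    rewrite s0; split=> // n _; apply: ((grid_hitP ZE rho0 s0 _ finS hit).2 _ n).
    split=> //; have [Zh _ _] := hit; have [_ th _] := ZE _ Zh.
    by move: Gz; rewrite angle_aroundE.
  case: ifP => // s0 [nN Vw]; split=> //; rewrite /preimage /= /Y asboolF//.
  have [[rho0 rad0 finS sur] [zh hit]] := good _ nN.
  have ZE := pp_sub Z_poisson (w := w).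
  have [Ls Gz] := (grid_hitP ZE rho0 s0 _ finS hit).1 (fun n => Vw n I).
  rewrite /hit_triple /Lhit /Upsilon /Theta /Radius (hit_markE rho0 finS hit).
  split=> //=; have [Zh _ _] := hit; have [_ th _] := ZE _ Zh.
  by rewrite angle_aroundE.
have mYgen s G : measurable G -> measurable (~` N `&` Y @^-1` gen s G).
  move=> mG; rewrite Y_gen//; case: ifP => // _; apply: measurableI.
    exact: measurableC.
  by apply: measurable_limit_event; exact: measurable_angle_pull.
have mY : measurable_fun setT Y.
  apply: (measurability _ (@gens_generate R)) => _ [_ [s [G [mG ->]]] <-].
  rewrite setTI -(setUIDK (Y @^-1` gen s G) N) setIC; apply: measurableU; last first.
    by rewrite setDE setIC; exact: mYgen.
  rewrite (_ : _ `&` _ = if `[< gen s G (0, 0, 0) >] then N else set0).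
    by case: ifP.
  apply/seteqP; split=> w.
    by move=> [Nw]; rewrite /preimage /= /Y asboolT// => h; rewrite asboolT.
  case: ifP => // /asboolP h Nw; split=> //.
  by rewrite /preimage /= /Y asboolT.
pose Ym : {mfun Omega >-> mark} := mfun_Sub (mem_set mY).
have YN B : measurable B -> P (Y @^-1` B) = P (~` N `&` Y @^-1` B).
  move=> mB; have mYB : measurable (Y @^-1` B).
    by rewrite -[X in measurable X]setTI; exact: (mY measurableT _ mB).
  rewrite (measureDI P mYB mN) setDE setIC.
  rewrite [X in (_ + X)%E](_ : _ = 0%E) ?adde0//.
  apply/eqP; rewrite -measure_le0 -N0; apply: le_measure.
  - by apply/mem_set/measurableI.
  - exact/mem_set.
  - by move=> w [].
exists Ym; split.
  exists N; split=> // w; apply: contra_notP => nN.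
  by rewrite /Ym /= /Y asboolF.
apply: (hit_law_unique mu_nonneg t_range (m := distribution P Ym)) => s G s0 mG;
  rewrite -[LHS]/(P (Y @^-1` gen s G)) YN; try exact: measurable_gen;
  rewrite Y_gen//.
  by rewrite ltNge s0 measure0.
rewrite s0; have mp := measurable_angle_pull t mG.
rewrite -(fineK (weight_fin mu_nonneg t_range mp)) -EFinM.
have [<- _] := limit_event_law s0 mp.
have mV := measurable_limit_event s mp.
rewrite [RHS](measureDI P mV mN) setDE setIC.
rewrite [X in (_ + X)%E](_ : _ = 0%E) ?adde0//.
apply/eqP; rewrite -measure_le0 -N0; apply: le_measure.
- by apply/mem_set/measurableI.
- exact/mem_set.
- by move=> w [].
Qed.

End first_line_law.

Unset Implicit Arguments.

Theorem theorem4p1 (R : realType)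
  (mu : probability (measurableTypeR R) R) (Rstar : R)
  (mu_nonneg : mu [set r : R | 0 <= r] = 1%E)
  (mu_mean : (\int[mu]_r (r : R)%:E = 1)%E)
  (mu_moment2 : (\int[mu]_r ((r : R) ^+ 2)%:E < +oo)%E)
  (Rstar_gt0 : 0 < Rstar)
  (mu_Rstar : mu [set r : R | Rstar < r] = 1%E)
  (d : measure_display) (Omega : measurableType d) (P : probability Omega R)
  (Z : Omega ->
     set (measurableTypeR R * measurableTypeR R * measurableTypeR R)%type)
  (Z_poisson : poisson_process P (@mark_space R) (intensity mu) Z)
  (K0 : set (R * R)) (K0_compact : compact K0)
  (t : R) (t_range : 0 <= t < 2 * pi) :
  {ae P, forall w,
     (fun lam : R => lam ^+ 2 * defect K0 (Z w) lam t) @ +oo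
       --> Zlimit (Z w) t} /\
  has_law P (fun w => hit_triple (Z w) t) (hit_law mu t).
Proof.
split; last exact: (hit_triple_law mu_nonneg mu_Rstar Z_poisson t_range).
have reg := ae_regular mu_nonneg mu_Rstar Z_poisson.
have hit := ae_first_hit mu_nonneg mu_Rstar Z_poisson t_range.
apply: filterS (filterI reg hit) => w [[rho0 rad finS sur] [zh hitw]].
exact: (cvg_defect Rstar_gt0 rho0 rad finS sur hitw K0).
Qed.
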